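(* Let $G$ be a finite simplicial graph, let $\Gamma=A(G)$ be the associated right-angled Artin group, acting on the universal covering $X$ of its Salvetti complex, and let $x$ be a vertex of $X$. Let $s=(h_1\supset\cdots\supset h_l)$ and $r=(k_1\supset\cdots\supset k_p)$ be $\mathcal{H}$-segments in $X$ such that neither of the labels $\lambda(h_1),\lambda(h_l)$ is connected by an edge in $G$ to either of the labels $\lambda(k_1),\lambda(k_p)$ (that is, none of the four pairs $\{\lambda(h_1),\lambda(k_1)\}$, $\{\lambda(h_1),\lambda(k_p)\}$, $\{\lambda(h_l),\lambda(k_1)\}$, $\{\lambda(h_l),\lambda(k_p)\}$ is an edge of $G$). Then $$[\delta^1\widehat{f_{s,x}}]\cup[\delta^1\widehat{f_{r,x}}]=0\in H^4_b(\Gamma;\mathbb{R}).$$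
   Context: Bounded cohomology: $C^n_b(\Gamma;\mathbb{R}):=\ell^\infty(\Gamma^{n+1},\mathbb{R})^\Gamma$ with the simplicial coboundary; $H^*_b(\Gamma;\mathbb{R})$ is its cohomology; the cup product is induced by $(f\cup g)(\gamma_0,\dots,\gamma_{p+q})=f(\gamma_0,\dots,\gamma_p)\,g(\gamma_p,\dots,\gamma_{p+q})$. RAAGs: $A(G)=\langle V(G)\mid vw=wv \text{ for } \{v,w\}\in E(G)\rangle$. The Salvetti complex $S(G)$ is the non-positively curved cube complex obtained from the presentation complex by gluing in a $k$-cube ($k$-torus) for each $k$-clique of $G$. Its universal covering $X$ is a $\mathrm{CAT}(0)$ cube complex: its $1$-skeleton is the Cayley graph of $\Gamma$ with respect to $V(G)$ (edges $\{g,gv\}$), it has one cube spanned by $\{g\prod_{v\in B}v : B\subseteq C\}$ for each $g\in\Gamma$ and each clique $C$, and $\Gamma$ acts freely by left multiplication. The label of the edge $\{g,gv\}$ is $v\in V(G)$. Halfspaces: let $D$ be the combinatorial path metric on the vertex set $V$ in the $1$-skeleton of $X$. For an edge $e$ with endpoints $a,b$, $V$ is the disjoint union of $\{v: D(v,a)<D(v,b)\}$ and $\{v: D(v,b)<D(v,a)\}$; each of these is called a halfspace, dual to $e$. All edges dual to the same halfspace $h$ have the same label, denoted $\lambda(h)$. For $x,y\in V$, $[x,y]_{\mathcal{H}}$ is the (finite) set of halfspaces containing $y$ but not $x$. Halfspaces $h\supset k$ are tightly nested if they are distinct and there is no halfspace $h'\neq h,k$ with $h\supset h'\supset k$. An $\mathcal{H}$-segment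 of length $l\geq1$ is a sequence $(h_1\supset\cdots\supset h_l)$ of halfspaces with consecutive ones tightly nested. Elements of $\Gamma s$ are called translates of $s$; a segment is contained in $[x,y]_{\mathcal{H}}$ if all its halfspaces are. Median quasimorphisms: $f_s(x,y)$ is the number of translates of $s$ contained in $[x,y]_{\mathcal{H}}$ minus the number of translates of $s$ contained in $[y,x]_{\mathcal{H}}$, and $f_{s,x}\colon\Gamma\to\mathbb{R}$, $f_{s,x}(\gamma):=f_s(x,\gamma x)$. This is a quasimorphism. For a quasimorphism $f$, $\widehat f(\gamma_0,\gamma_1):=f(\gamma_0^{-1}\gamma_1)$, and $\delta^1\widehat f$ is a bounded cocycle defining a class in $H^2_b(\Gamma;\mathbb{R})$. *)

(* Defs.v *)
From HB Require Import structures.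
From mathcomp Require Import all_boot all_order all_algebra.
From mathcomp Require Import generic_quotient ring_quotient finmap zify.
From mathcomp Require Import boolp classical_sets functions cardinality reals.

Set Implicit Arguments.
Unset Strict Implicit.
Unset Printing Implicit Defensive.

Import Order.TTheory GRing.Theory Num.Theory.
Import Quotient.

Local Open Scope classical_set_scope.
Local Open Scope ring_scope.
Local Open Scope quotient_scope.

(** * Bounded cohomology of a group with trivial real coefficients *)

Section BoundedCohomology.
Variables (R : realType) (G : groupType).

Local Notation cochain n := (('I_n.+1 -> G) -> R).

Definition coboundary n (f : cochain n) : cochain n.+1 :=
  fun g => \sum_(i < n.+2) (-1) ^+ i * f (fun j => g (lift i j)).

Definition bounded_cochain n (f : cochain n) : Prop :=
  exists M : R, forall g, `|f g| <= M.

Definition invariant_cochain n (f : cochain n) : Prop :=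
  forall (a : G) g, f (fun i => (a * g i)%g) = f g.

(* Membership in $\ell^\infty(\Gamma^{n+1},\mathbb{R})^\Gamma$. *)
Definition in_Cb n (f : cochain n) : Prop :=
  bounded_cochain f /\ invariant_cochain f.

(** ** The coboundary is additive and squares to zero *)

Lemma coboundary_is_zmod_morphism n : zmod_morphism (@coboundary n).
Proof.
move=> f h; apply/funext => g.
rewrite /coboundary [RHS]/GRing.add /= [X in _ + X]/GRing.opp /= -sumrB.
by apply: eq_bigr => i _; rewrite -mulrBr.
Qed.

HB.instance Definition _ n :=
  GRing.isZmodMorphism.Build (cochain n) (cochain n.+1) (@coboundary n)
    (@coboundary_is_zmod_morphism n).

Let bump_flip i j : bump (bump i j) (unbump j i) = i.
Proof. by rewrite /bump /unbump; case: (leqP i j) => ?; lia. Qed.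

Let unbump_flip i j : unbump (unbump j i) (bump i j) = j.
Proof. by rewrite /bump /unbump; case: (leqP i j) => ?; lia. Qed.

Let odd_flip i j : odd (bump i j + unbump j i) = ~~ odd (i + j).
Proof. by rewrite /bump /unbump; case: (leqP i j) => ?; lia. Qed.

Let flip n (p : 'I_n.+3 * 'I_n.+2) : 'I_n.+3 * 'I_n.+2 :=
  (lift p.1 p.2, inord (unbump p.2 p.1)).

Let flipE n (p : 'I_n.+3 * 'I_n.+2) :
  (flip p).2 = unbump p.2 p.1 :> nat.
Proof.
case: p => -[i hi] [j hj] /=; rewrite inordK // /unbump.
by case: (ltnP j i) => ?; lia.
Qed.

Let flipK n : involutive (@flip n).
Proof.
move=> p; have E := flipE p; have E2 := flipE (flip p).
apply/eqP; rewrite /eq_op /=; apply/andP; split; apply/eqP/val_inj => /=.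
  by rewrite E bump_flip.
by rewrite [LHS]E2 E /= unbump_flip.
Qed.

Lemma coboundaryK n (f : cochain n) : coboundary (coboundary f) = 0.
Proof.
apply/funext => g; rewrite /coboundary.
under eq_bigr => i _ do rewrite big_distrr /=.
rewrite pair_big /=; set S := \sum_(p | _) _.
suff SS : S = - S.
  have /eqP : S + S = 0 by rewrite {1}SS addNr.
  by rewrite -mulr2n mulrn_eq0 /= => /eqP ->.
rewrite {1}/S (reindex_inj (inv_inj (@flipK n))) /= /S -sumrN.
apply: eq_bigr => p _; have E := flipE p.
rewrite !mulrA -!exprD -mulNr; congr (_ * _).
  rewrite -signr_odd -[in RHS]signr_odd [in LHS]E /= odd_flip.
  by case: odd; rewrite /= ?opprK.
congr f; apply/funext => k; congr g; apply: val_inj => /=.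
by rewrite [X in bump _ (bump X _)]E -bumpC.
Qed.

(** ** The graded group $H^*_b(\Gamma;\mathbb{R})$ *)

Definition bcocycle n : {pred cochain n} :=
  [pred f | `[< in_Cb f /\ coboundary f = 0 >]].

Lemma bcocycle_zmod_closed n : zmod_closed (@bcocycle n).
Proof.
split=> [|f h /asboolP [[[M fM] fi] f0] /asboolP [[[N hN] hi] h0]].
  apply/asboolP; split; last exact: raddf0.
  by split; [exists 0 => g; rewrite normr0 | move=> a g].
apply/asboolP; split; last by rewrite raddfB /= f0 h0 subr0.
split; last by move=> a g; rewrite /GRing.add /GRing.opp /= fi hi.
exists (M + N) => g; apply: le_trans (lerD (fM g) (hN g)).
exact: ler_normB.
Qed.

HB.instance Definition _ n :=
  GRing.isZmodClosed.Build (cochain n) (@bcocycle n) (@bcocycle_zmod_closed n).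

Record Zb n := MkZb { Zb_val :> cochain n; Zb_prop : Zb_val \in @bcocycle n }.

HB.instance Definition _ n := [isSub for @Zb_val n].
HB.instance Definition _ n := [Choice of Zb n by <:].
HB.instance Definition _ n := [SubChoice_isSubZmodule of Zb n by <:].

Definition is_bcoboundary n : cochain n -> Prop :=
  match n with
  | 0 => fun f => f = 0
  | m.+1 => fun f => exists h : cochain m, in_Cb h /\ f = coboundary h
  end.

Definition bcoboundary n : {pred Zb n} :=
  [pred f : Zb n | `[< is_bcoboundary f >]].

Lemma bcoboundary_zmod_closed n : zmod_closed (@bcoboundary n).
Proof.
case: n => [|n]; split=> [|f h /asboolP /= Hf /asboolP /= Hh].
- exact/asboolP.
- by apply/asboolP; rewrite /= Hf Hh subr0.
- apply/asboolP; exists 0; split; last by rewrite raddf0.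
  by split; [exists 0 => g; rewrite normr0 | move=> a g].
- case: Hf => f' [[[M fM] fi] fE]; case: Hh => h' [[[N hN] hi] hE].
  apply/asboolP; exists (f' - h'); split; last by rewrite raddfB /= fE hE.
  split; last by move=> a g; rewrite /GRing.add /GRing.opp /= fi hi.
  exists (M + N) => g; apply: le_trans (lerD (fM g) (hN g)).
  exact: ler_normB.
Qed.

HB.instance Definition _ n :=
  GRing.isZmodClosed.Build (Zb n) (@bcoboundary n) (@bcoboundary_zmod_closed n).

Definition Hb n : zmodType := {quot (@bcoboundary n)}.

Definition Hclass n (f : Zb n) : Hb n := \pi_({quot (@bcoboundary n)}) f.

Lemma Hclass_eq n (f h : Zb n) :
  Hclass f = Hclass h <-> is_bcoboundary (Zb_val f - Zb_val h).
Proof.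
rewrite /Hclass; split=> [/eqP|H].
  by rewrite -idealrBE => /asboolP.
by apply/eqP; rewrite -idealrBE; apply/asboolP.
Qed.

(** ** The cup product *)

(* The values i <= p and p + j <= p + q are in range, so [inord] just casts them
   to 'I_(p + q).+1. *)
Definition cup p q (f : cochain p) (h : cochain q) : cochain (p + q) :=
  fun g => f (fun i => g (inord i)) * h (fun j => g (inord (p + j))).

Lemma coboundary_cup p q (f : cochain p) (h : cochain q)
    (g : 'I_(p + q).+2 -> G) :
  coboundary (cup f h) g =
    coboundary f (fun i => g (inord i)) * h (fun j => g (inord (p.+1 + j)))
    + (-1) ^+ p * (f (fun i => g (inord i)) *
                   coboundary h (fun j => g (inord (p + j)))).
Proof.
pose gn k : G := g (inord k).
pose A i := f (fun j => gn (bump i j)).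
pose B i := h (fun j => gn (bump i (p + j))).
set f0 := f _; set h0 := h _.
have Af i : (p < i)%N -> A i = f0.
  move=> pi; congr f; apply/funext => j; congr gn.
  by rewrite /bump; case: j => j /=; lia.
have Bh i : (i <= p)%N -> B i = h0.
  move=> ip; congr h; apply/funext => j; congr gn.
  by rewrite /bump; case: j => j /=; lia.
have -> : coboundary (cup f h) g =
    \sum_(0 <= i < (p + q).+2) (-1) ^+ i * (A i * B i).
  rewrite big_mkord; apply: eq_bigr => i _; congr (_ * (_ * _)).
    congr f; apply/funext => j; congr g; apply: val_inj => /=.
    by case: i j => i hi [j hj]; rewrite !inordK // /bump /=; lia.
  congr h; apply/funext => j; congr g; apply: val_inj => /=.
  by case: i j => i hi [j hj]; rewrite !inordK // /bump /=; lia.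
have -> : coboundary f (fun i => g (inord i)) =
    \sum_(0 <= i < p.+2) (-1) ^+ i * A i.
  by rewrite big_mkord.
have -> : coboundary h (fun j => g (inord (p + j))) =
    \sum_(0 <= i < q.+2) (-1) ^+ i * B (p + i)%N.
  rewrite big_mkord; apply: eq_bigr => i _; congr (_ * _).
  congr h; apply/funext => j; congr gn.
  by rewrite /= /bump; case: i j => i hi [j hj] /=; lia.
rewrite (@big_cat_nat _ _ _ p.+1) //=; last by lia.
rewrite [\sum_(0 <= i < p.+2) _]big_nat_recr //= (Af p.+1) //.
rewrite [\sum_(0 <= i < q.+2) _]big_nat_recl //= addn0 (Bh p) //.
rewrite expr0 mul1r mulrDl -addrA; congr (_ + _).
  rewrite mulr_suml; apply: eq_big_nat => i /andP[_ ip].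
  by rewrite Bh // mulrA.
rewrite !mulrDr addrA exprS mulN1r !mulNr mulrA addNr add0r.
rewrite -{1}[p.+1]add0n big_addn mulr_sumr mulr_sumr.
have -> : ((p + q).+2 - p.+1 = q.+1)%N by lia.
apply: eq_big_nat => i _; rewrite Af; last by lia.
have -> : (i + p.+1 = p + i.+1)%N by lia.
by rewrite exprD -!mulrA; congr (_ * _); rewrite mulrCA.
Qed.

Lemma cup_in_Cb p q (f : cochain p) (h : cochain q) :
  in_Cb f -> in_Cb h -> in_Cb (cup f h).
Proof.
case=> -[M fM] fi [[N hN] hi]; split; last by move=> a g; rewrite /cup /= fi hi.
exists (M * N) => g; rewrite /cup normrM.
by apply: ler_pM; rewrite ?normr_ge0.
Qed.

Lemma cup_bcocycle p q (f : Zb p) (h : Zb q) : cup f h \in @bcocycle (p + q).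
Proof.
case: f => f /= /asboolP [fb f0]; case: h => h /= /asboolP [hb h0].
apply/asboolP; split; first exact: cup_in_Cb.
by apply/funext => g; rewrite coboundary_cup f0 h0 mul0r !mulr0 addr0.
Qed.

Definition cupZ p q (f : Zb p) (h : Zb q) : Zb (p + q) :=
  MkZb (cup_bcocycle f h).

(* Computed on representatives; [cupH_class] shows independence of the choice. *)
Definition cupH p q (a : Hb p) (b : Hb q) : Hb (p + q) :=
  Hclass (cupZ (repr (a : {quot (@bcoboundary p)}))
               (repr (b : {quot (@bcoboundary q)}))).

Lemma is_bcoboundary_cupl p q (f : cochain p) (h : Zb q) :
  is_bcoboundary f -> is_bcoboundary (cup f h).
Proof.
case: h => h /= /asboolP [hb h0].
case: p f => [|p] f.
  move=> /= ->; have -> : cup (0 : cochain 0) h = 0.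
    by apply/funext => g; rewrite /cup /= mul0r.
  exact/asboolP/(rpred0 (@bcoboundary (0 + q)%N)).
move=> [f' [f'b ->]]; exists (cup f' h); split; first exact: cup_in_Cb.
by apply/funext => g; rewrite coboundary_cup h0 !mulr0 addr0.
Qed.

Lemma is_bcoboundary_cupr p q (f : Zb p) (h : cochain q) :
  is_bcoboundary h -> is_bcoboundary (cup f h).
Proof.
case: f => f /= /asboolP [fb f0].
case: q h => [|q] h.
  move=> /= ->; have -> : cup f (0 : cochain 0) = 0.
    by apply/funext => g; rewrite /cup /= mulr0.
  exact/asboolP/(rpred0 (@bcoboundary (p + 0)%N)).
move=> [h' [h'b ->]]; rewrite /cup.
have : forall n, n = (p + q).+1 -> is_bcoboundary (fun g : 'I_n.+1 -> G =>
    f (fun i => g (inord i)) * coboundary h' (fun j => g (inord (p + j)))).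
  move=> n ->; pose f1 := if odd p then - f else f.
  have /asboolP [f1b f10] : f1 \in @bcocycle p.
    have fZ : f \in @bcocycle p by apply/asboolP.
    by rewrite /f1; case: odd; rewrite ?rpredN.
  exists (cup f1 h'); split; first exact: cup_in_Cb.
  apply/funext => g; rewrite coboundary_cup f10 mul0r add0r -signr_odd /f1.
  case: odd; last by rewrite expr0 mul1r.
  rewrite expr1 mulN1r; have -> u : (- f) u = - f u by [].
  by rewrite mulNr opprK.
by apply; rewrite addnS.
Qed.

Lemma cupH_class p q (f : Zb p) (h : Zb q) :
  cupH (Hclass f) (Hclass h) = Hclass (cupZ f h).
Proof.
set f' := repr (Hclass f : {quot (@bcoboundary p)}).
set h' := repr (Hclass h : {quot (@bcoboundary q)}).
have Ef : is_bcoboundary (Zb_val f' - Zb_val f).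
  by apply/Hclass_eq; rewrite /Hclass reprK.
have Eh : is_bcoboundary (Zb_val h' - Zb_val h).
  by apply/Hclass_eq; rewrite /Hclass reprK.
apply/Hclass_eq => /=; rewrite -/f' -/h'.
have -> : cup f' h' - cup f h =
    cup (Zb_val f' - Zb_val f) h' + cup f (Zb_val h' - Zb_val h).
  apply/funext => g; rewrite /cup [LHS]/GRing.add /= [X in _ + X]/GRing.opp /=.
  have subE n (u w : cochain n) c : (u - w) c = u c - w c by [].
  by rewrite [RHS]/GRing.add /= !subE mulrBl mulrBr addrA subrK.
have H1 : cupZ (f' - f) h' \in @bcoboundary (p + q)%N.
  exact/asboolP/is_bcoboundary_cupl.
have H2 : cupZ f (h' - h) \in @bcoboundary (p + q)%N.
  exact/asboolP/is_bcoboundary_cupr.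
exact/asboolP/(rpredD H1 H2).
Qed.

(** ** The class of a quasimorphism *)

Definition quasimorphism (f : G -> R) : Prop :=
  exists D : R, forall a b : G, `|f a + f b - f (a * b)%g| <= D.

(* 'I_2 indexes the pair $(\gamma_0,\gamma_1)$ *)
Definition qhat (f : G -> R) : cochain 1 :=
  fun g => f ((g ord0)^-1 * g ord_max)%g.

Lemma coboundary_qhat_bcocycle f :
  quasimorphism f -> coboundary (qhat f) \in @bcocycle 2.
Proof.
case=> D fD; apply/asboolP; split; last exact: coboundaryK.
split.
  exists D => g.
  set a := ((g (inord 0))^-1 * g (inord 1))%g.
  set b := ((g (inord 1))^-1 * g (inord 2))%g.
  suff -> : coboundary (qhat f) g = f a + f b - f (a * b)%g by exact: fD.
  rewrite /coboundary !big_ord_recl big_ord0 /qhat /=.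
  have -> : (a * b = (g (inord 0))^-1 * g (inord 2))%g by rewrite /a/b -!mulgA mulVKg.
  rewrite expr0 expr1 sqrrN mul1r mulN1r expr1n mul1r addr0.
  rewrite addrA addrAC [f a + f b]addrC.
  congr (f _ + f _ - f _); congr (_ * _)%g; [congr (_ ^-1)%g| |congr (_ ^-1)%g| |congr (_ ^-1)%g|];
    by congr g; apply: val_inj; rewrite /= inordK.
move=> c g; apply: eq_bigr => i _; congr (_ * _); rewrite /qhat.
by rewrite invgM -mulgA mulKg.
Qed.

(* $[\delta^1\widehat f]\in H^2_b(\Gamma;\mathbb{R})$; it depends on [f] only,
   proofs of [quasimorphism f] being all equal. *)
Definition qclass (f : G -> R) (qf : quasimorphism f) : Hb 2 :=
  Hclass (MkZb (coboundary_qhat_bcocycle qf)).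

End BoundedCohomology.

(** * Right-angled Artin groups *)

Section RAAG.
Variables (V : finType) (e : rel V).

(* A letter (v, true) stands for $v$ and (v, false) for $v^{-1}$. *)
Definition word := seq (V * bool).

(* The congruence presenting $A(G)$ as a quotient of the free monoid on letters. *)
Inductive raag_congr : word -> word -> Prop :=
| raag_refl w : raag_congr w w
| raag_sym w w' : raag_congr w w' -> raag_congr w' w
| raag_trans w w' w'' :
    raag_congr w w' -> raag_congr w' w'' -> raag_congr w w''
| raag_cat u u' w w' :
    raag_congr u u' -> raag_congr w w' -> raag_congr (u ++ w) (u' ++ w')
| raag_cancel v b : raag_congr [:: (v, b); (v, ~~ b)] [::]
| raag_comm v w : e v w ->
    raag_congr [:: (v, true); (w, true)] [:: (w, true); (v, true)].

Definition raag_rel : rel word := fun w w' => `[< raag_congr w w' >].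

Lemma raag_rel_equiv : equiv_class_of raag_rel.
Proof.
split=> [w|w w'|w' w w''].
- exact/asboolP/raag_refl.
- by apply/asboolP/asboolP; apply: raag_sym.
- by move=> /asboolP H /asboolP K; apply/asboolP/raag_trans/K.
Qed.

Canonical raag_equiv := EquivRelPack raag_rel_equiv.
Canonical raag_encModRel := defaultEncModRel raag_rel.

Definition raag := {eq_quot raag_rel}.

HB.instance Definition _ : EqQuotient word raag_rel raag := EqQuotient.on raag.
HB.instance Definition _ := Choice.on raag.

Definition raag_word (w : word) : raag := \pi_raag w.

Lemma raag_wordP w w' : raag_word w = raag_word w' <-> raag_congr w w'.
Proof.
rewrite /raag_word; split=> [/eqP|H]; first by rewrite piE => /asboolP.
by apply/eqP; rewrite piE; apply/asboolP.
Qed.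

Lemma raag_repr (a : raag) : raag_word (repr a) = a.
Proof. exact: reprK. Qed.

Definition word_inv (w : word) : word := rev [seq (l.1, ~~ l.2) | l <- w].

Definition raag_one : raag := raag_word [::].
Definition raag_mul (a b : raag) : raag := raag_word (repr a ++ repr b).
Definition raag_inv (a : raag) : raag := raag_word (word_inv (repr a)).

Lemma raag_word_cat u w : raag_mul (raag_word u) (raag_word w) = raag_word (u ++ w).
Proof. by apply/raag_wordP/raag_cat; apply/raag_wordP/raag_repr. Qed.

Lemma raag_mulA : associative raag_mul.
Proof.
move=> a b c; rewrite -(raag_repr a) -(raag_repr b) -(raag_repr c).
by rewrite !raag_word_cat catA.
Qed.

Lemma raag_mul1 : left_id raag_one raag_mul.
Proof. by move=> a; rewrite -(raag_repr a) raag_word_cat. Qed.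

Lemma raag_1mul : right_id raag_one raag_mul.
Proof. by move=> a; rewrite -(raag_repr a) raag_word_cat cats0. Qed.

Lemma word_invK w : raag_congr (w ++ word_inv w) [::].
Proof.
elim: w => [|[v b] w IH]; first exact: raag_refl.
rewrite /word_inv /= rev_cons -cats1 catA -cat_cons -cat1s.
apply: raag_trans (raag_cancel v b); rewrite -[X in raag_congr _ X]/([:: _] ++ [:: _]).
rewrite -catA; apply: raag_cat (raag_refl _) _.
rewrite -[X in raag_congr _ X]cat0s.
exact: raag_cat IH (raag_refl _).
Qed.

Lemma word_inv_inv : involutive word_inv.
Proof.
move=> w; rewrite /word_inv map_rev revK -map_comp.
by apply: map_id_in => -[v b] _ /=; rewrite negbK.
Qed.

Lemma raag_mulV : right_inverse raag_one raag_inv raag_mul.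
Proof.
move=> a; rewrite -{1}(raag_repr a) raag_word_cat.
exact/raag_wordP/word_invK.
Qed.

Lemma raag_Vmul : left_inverse raag_one raag_inv raag_mul.
Proof.
move=> a; rewrite -{2}(raag_repr a) raag_word_cat; apply/raag_wordP.
by rewrite -{2}(word_inv_inv (repr a)); apply: word_invK.
Qed.

HB.instance Definition _ := isGroup.Build raag
  raag_mulA raag_mul1 raag_1mul raag_Vmul raag_mulV.

Definition gen (v : V) : raag := raag_word [:: (v, true)].

(** ** The 1-skeleton of the universal covering of the Salvetti complex

  The vertex set of the universal covering is the group itself, acting by left
  multiplication, and the 1-skeleton is the Cayley graph. Halfspaces depend on
  the 1-skeleton only. *)

Definition adj : rel raag :=
  fun a b => [exists v, (b == a * gen v)%g || (a == b * gen v)%g].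

Definition walk (a b : raag) (n : nat) : Prop :=
  exists p : seq raag, [/\ path adj a p, last a p = b & size p = n].

Lemma walk_word a w : walk a (a * raag_word w)%g (size w).
Proof.
elim: w a => [|[v b] w IH] a; first by exists [::]; rewrite /= mulg1.
have [p [pp pl ps]] := IH (a * raag_word [:: (v, b)])%g.
exists ((a * raag_word [:: (v, b)])%g :: p); split=> //=; last by rewrite ps.
  rewrite pp andbT; apply/existsP; exists v; case: b {IH pp pl} => /=.
    by rewrite eqxx.
  have -> : (a * raag_word [:: (v, false)] * gen v)%g = a.
    rewrite -mulgA [X in (_ * X)%g](raag_word_cat [:: _] [:: _]).
    have -> : raag_word ([:: (v, false)] ++ [:: (v, true)]) = 1%g.
      exact/raag_wordP/raag_cancel.
    by rewrite mulg1.
  by rewrite eqxx orbT.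
by rewrite pl -mulgA [X in (_ * X)%g = _](raag_word_cat [:: _]).
Qed.

Lemma walk_ex a b : exists n, `[< walk a b n >].
Proof.
exists (size (repr (a^-1 * b)%g)); apply/asboolP.
by have := walk_word a (repr (a^-1 * b)%g); rewrite raag_repr mulVKg.
Qed.

(* The combinatorial path metric $D$. *)
Definition dist (a b : raag) : nat := ex_minn (walk_ex a b).

(** ** Halfspaces *)

Definition closer (a b : raag) : set raag := [set z | (dist z a < dist z b)%N].

Definition halfspace (h : set raag) : Prop :=
  exists a b, adj a b /\ h = closer a b.

(* As a relation, $\lambda(h)=v$: $h$ is dual to an edge $\{g,gv\}$ *)
Definition halfspace_label (h : set raag) (v : V) : Prop :=
  exists g, h = closer g (g * gen v)%g \/ h = closer (g * gen v)%g g.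

Definition separating (x y : raag) : set (set raag) :=
  [set h | [/\ halfspace h, h y & ~ h x]].

Definition tightly_nested (h k : set raag) : Prop :=
  k `<` h /\
  ~ exists h', [/\ halfspace h', h' != h, h' != k, k `<=` h' & h' `<=` h].

(* The sequence $(h_1\supset\dots\supset h_l)$, with $l\geq 1$. *)
Definition Hsegment (s : seq (set raag)) : Prop :=
  [/\ s != [::], (forall h, h \in s -> halfspace h) &
      sorted (fun h k => `[< tightly_nested h k >]) s].

Definition translate (g : raag) (s : seq (set raag)) : seq (set raag) :=
  [seq [set (g * z)%g | z in h] | h : set raag <- s].

Definition translates_in (s : seq (set raag)) (x y : raag) :
    set (seq (set raag)) :=
  [set t | (exists g, t = translate g s) /\
           (forall h, h \in t -> separating x y h)].

(** ** Median quasimorphisms *)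

Variable R : realType.

(* $f_s(x,y)$. Intervals contain finitely many halfspaces, so [fset_set], which
   returns the empty set on infinite sets, gives the actual cardinalities. *)
Definition median_cocycle (s : seq (set raag)) (x y : raag) : R :=
  (#|` fset_set (translates_in s x y)|)%:R
  - (#|` fset_set (translates_in s y x)|)%:R.

(* $f_{s,x}$ *)
Definition median_qm (s : seq (set raag)) (x : raag) : raag -> R :=
  fun g => median_cocycle s x (g * x)%g.

End RAAG.

(* Main.v *)
Require Import Defs.
From HB Require Import structures.
From mathcomp Require Import all_boot all_order all_algebra.
From mathcomp Require Import generic_quotient ring_quotient finmap zify.
From mathcomp Require Import boolp classical_sets functions cardinality reals.

Set Implicit Arguments.
Unset Strict Implicit.
Unset Printing Implicit Defensive.

(** A translate [t] of [s] contributes to $f_s(y,z)$ through the positions of [y]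
  and [z] with respect to its first and last halfspaces only. Each point lies
  outside the first one, between the two, or inside the last one, and $\delta f_s$
  counts, with signs, the translates for which three given points lie in three
  different zones.

  With $\omega=\delta^1\widehat{f_r}$, the cochain $f_s\cup\omega$ is a primitive of
  the cup product, but it is unbounded. We add to it the coboundary of
  $\eta(y_0,y_1,y_2)=f_s(y_0,m)\,\omega(y_0,y_1,y_2)$, where $m$ is the median of the
  three points, so that $f_s(y_0,m)$ is decided by majority votes. The sum is
  bounded: it is a sum over pairs $(t,u)$ of translates of [s] and [r], and a pair
  with a nonzero term is such that $u$ has the four points in three different zones
  and either $t$ too, or the first or last halfspace of $t$ (or its complement)
  lies between the last and the first halfspace of $u$, because nonadjacent labels
  make the halfspaces of $t$ and $u$ nontransverse. There are boundedly many such
  pairs, since the translates contained in an interval form a chain.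

  The geometry needed is that halfspaces with nonadjacent labels are not
  transverse, that tightly nested ones have nonadjacent labels, and that intervals
  are finite. Everything follows from the solution of the word problem by piles:
  the projections of a reduced word to all pairs of nonadjacent generators. *)
(** * Normal forms in a right-angled Artin group *)

Section Letters.
Variables (V : finType) (e : rel V).
Hypotheses (e_sym : symmetric e) (e_irr : irreflexive e).

Local Notation letter := (V * bool)%type.
Local Notation G := (raag e).

Definition linv (a : letter) : letter := (a.1, ~~ a.2).

Lemma linvK : involutive linv.
Proof. by case=> v b; rewrite /linv /= negbK. Qed.

Definition letg (a : letter) : G := raag_word e [:: a].

Lemma raag_word_cons a w : raag_word e (a :: w) = (letg a * raag_word e w)%g.
Proof. by rewrite [RHS](raag_word_cat e [:: a]). Qed.

Lemma letg_linv a : letg (linv a) = (letg a)^-1%g.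
Proof.
apply: (mulgI (letg a)); rewrite mulgV [LHS](raag_word_cat e [:: a] [:: linv a]).
by apply/raag_wordP; case: a => v b; apply: raag_cancel.
Qed.

(** The presentation has this relation for positive letters only; in the group, commuting with an
    element implies commuting with its inverse. *)
Lemma raag_congr_comm a b : e a.1 b.1 -> raag_congr e [:: a; b] [:: b; a].
Proof.
move=> ab.
pose cc (x y : G) := (x * y)%g = (y * x)%g.
have ccV x y : cc x y -> cc x y^-1%g.
  by move=> H; apply: (mulgI y); rewrite mulgA -H mulgK mulVKg.
have main : cc (letg (a.1, true)) (letg (b.1, true)).
  rewrite /cc [LHS](raag_word_cat e [:: _] [:: _]) [RHS](raag_word_cat e [:: _] [:: _]).
  exact/raag_wordP/raag_comm.
suff : cc (letg a) (letg b).
  rewrite /cc [LHS](raag_word_cat e [:: _] [:: _]) [RHS](raag_word_cat e [:: _] [:: _]).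
  by move/raag_wordP.
have bb x : cc x (letg (b.1, true)) -> cc x (letg b).
  case: (b) => v [] //= H.
  by rewrite -[(v, false)]/(linv (v, true)) letg_linv; apply: ccV.
apply: bb; case: (a) main => v [] //= H.
rewrite -[(v, false)]/(linv (v, true)) letg_linv; apply/esym/ccV/esym; exact: H.
Qed.

Lemma letg_comm a b : e a.1 b.1 -> (letg a * letg b)%g = (letg b * letg a)%g.
Proof.
move=> ab.
rewrite [LHS](raag_word_cat e [:: _] [:: _]) [RHS](raag_word_cat e [:: _] [:: _]).
exact/raag_wordP/raag_congr_comm.
Qed.

(** A pile projects a word to each pair of nonadjacent generators, diagonal pairs [(v, v)] included;
    [supp a i] says that [a] survives the projection to [i]. Coordinates at adjacent pairs stay
    empty. *)
Definition supp (a : letter) (i : V * V) : bool :=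
  ~~ e i.1 i.2 && ((a.1 == i.1) || (a.1 == i.2)).

Lemma supp_adj a b i : e a.1 b.1 -> supp a i -> supp b i = false.
Proof.
case: i => c d ab; rewrite /supp /= => /andP[ncd]; rewrite ncd /= => Ea.
apply/negP => Eb; move: ab.
case/orP: Ea => /eqP ->; case/orP: Eb => /eqP ->; rewrite ?e_irr ?(negbTE ncd) //.
by rewrite e_sym (negbTE ncd).
Qed.

Lemma supp_nadj a b : ~~ e a.1 b.1 -> exists i, supp a i && supp b i.
Proof. by move=> ab; exists (a.1, b.1); rewrite /supp /= ab !eqxx orbT. Qed.

Lemma supp_linv a i : supp (linv a) i = supp a i.
Proof. by []. Qed.

(** * Piles and the action of letters on them *)

Definition pile := V * V -> seq letter.
Definition pile0 : pile := fun=> [::].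
Definition pcons (a : letter) (p : pile) : pile :=
  fun i => if supp a i then a :: p i else p i.
Definition pdel (a : letter) (p : pile) : pile :=
  fun i => if supp a i then behead (p i) else p i.
(** Commutations can then bring [a] to the front of the word, see [headed_foldr]. *)
Definition headed (a : letter) (p : pile) : Prop :=
  forall i, supp a i -> ohead (p i) = Some a.

Definition push (a : letter) (p : pile) : pile :=
  if `[< headed (linv a) p >] then pdel (linv a) p else pcons a p.

Lemma pconsK a : cancel (pcons a) (pdel a).
Proof. by move=> p; apply/funext => i; rewrite /pdel /pcons; case: (supp a i). Qed.

Lemma pdelK a p : headed a p -> pcons a (pdel a p) = p.
Proof.
move=> H; apply/funext => i; rewrite /pdel /pcons; case ai: (supp a i) => //.
by have := H i ai; case: (p i) => //= ? ? [->].
Qed.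

Lemma headed_cons a p : headed a (pcons a p).
Proof. by move=> i ai; rewrite /pcons ai. Qed.

Lemma headed_consE a b p : e a.1 b.1 -> headed b (pcons a p) <-> headed b p.
Proof.
rewrite e_sym => ab; split=> H i bi; have := H i bi; by rewrite /pcons (supp_adj ab bi).
Qed.

Lemma headed_delE a b p : e a.1 b.1 -> headed b (pdel a p) <-> headed b p.
Proof.
rewrite e_sym => ab; split=> H i bi; have := H i bi; by rewrite /pdel (supp_adj ab bi).
Qed.

Lemma headed_push a b p : e a.1 b.1 -> headed b (push a p) <-> headed b p.
Proof.
by move=> ab; rewrite /push; case: asboolP => _; [apply: headed_delE|apply: headed_consE].
Qed.

(** Nonadjacent letters share a coordinate, which has only one top. *)
Lemma headed_disj a b p : ~~ e a.1 b.1 -> headed a p -> headed b p -> a = b.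
Proof.
move=> /supp_nadj[i /andP[ai bi]] Ha Hb.
by have := Ha i ai; rewrite Hb // => -[->].
Qed.

Lemma pcons_comm a b p : e a.1 b.1 -> pcons a (pcons b p) = pcons b (pcons a p).
Proof.
move=> ab; apply/funext => i; rewrite /pcons; case: ifP => ai //.
by rewrite (supp_adj ab ai).
Qed.

(* The image of the reduced words: no letter is put on top of its inverse. *)
Inductive reduced : pile -> Prop :=
| reduced0 : reduced pile0
| reducedS a p : reduced p -> ~ headed (linv a) p -> reduced (pcons a p).

(** Two letters heading the same pile are equal or adjacent. Thus the last letter put on the pile is
    [a] itself, or it commutes with [a] and the deletion takes place below it. *)
Lemma reduced_del a p : reduced p -> headed a p ->
  reduced (pdel a p) /\ ~ headed (linv a) (pdel a p).
Proof.
elim=> [/(_ (a.1, a.1))|c p' rp' IH Hc Ha].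
  by rewrite /supp /= e_irr eqxx => /(_ isT).
have [<-|ca] := eqVneq c a; first by rewrite pconsK.
have ac : e a.1 c.1.
  apply: contra_notT (elimN eqP ca) => ac; apply/esym.
  exact: headed_disj ac Ha (@headed_cons c p').
have ca' : e c.1 a.1 by rewrite e_sym.
have Ha' : headed a p' by apply/(headed_consE _ ca').
have [r1 r2] := IH Ha'.
have -> : pdel a (pcons c p') = pcons c (pdel a p').
  by rewrite -{1}(pdelK Ha') (pcons_comm _ ca') pconsK.
split; last by rewrite headed_consE.
constructor=> // H; apply: Hc; move: H; rewrite headed_delE //.
Qed.

Lemma reduced_push a p : reduced p -> reduced (push a p).
Proof.
move=> rp; rewrite /push; case: asboolP => [H|H]; last exact: reducedS.
by have [] := reduced_del rp H.
Qed.

Lemma pushK a p : reduced p -> push a (push (linv a) p) = p.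
Proof.
move=> rp; rewrite {2}/push linvK; case: asboolP => H.
  have [_] := reduced_del rp H; rewrite /push => /asboolPn /negbTE ->.
  exact: pdelK.
by rewrite /push asboolT ?pconsK //; apply: headed_cons.
Qed.

Lemma push_comm a b p : e a.1 b.1 -> push a (push b p) = push b (push a p).
Proof.
move=> ab; have ba : e b.1 a.1 by rewrite e_sym.
have E c d q : e c.1 d.1 -> `[< headed (linv d) (push c q) >] = `[< headed (linv d) q >].
  by move=> cd; apply/asbool_equiv_eq/headed_push.
have pE c q : push c q = if `[< headed (linv c) q >] then pdel (linv c) q else pcons c q by [].
rewrite [LHS]pE [RHS]pE !E // !pE; apply/funext => i.
have := @supp_adj _ _ i ab; case: ifP => _; case: ifP => _; rewrite /pdel /pcons ?supp_linv;
  by case: (supp a i) => [->|]; last case: (supp b i).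
Qed.

Definition pushes (w : word V) (p : pile) : pile := foldr push p w.

Lemma reduced_pushes w p : reduced p -> reduced (pushes w p).
Proof. by move=> rp; elim: w => //= a w; apply: reduced_push. Qed.

(** Each defining relation holds for the action on reduced piles; reducedness makes [push a] and
    [push (linv a)] inverse to each other. So the pile depends on the group element only. *)
Lemma pushes_congr w w' : raag_congr e w w' ->
  forall p, reduced p -> pushes w p = pushes w' p.
Proof.
elim=> {w w'} [//|w w' _ IH p rp|w w' w'' _ IH _ IH' p rp|u u' w w' _ IH _ IH' p rp
  |v b p rp|v w vw p rp].
- by rewrite IH.
- by rewrite IH // IH'.
- rewrite /pushes !foldr_cat -/(pushes w p) -/(pushes w' p) IH' //.
  by apply: IH; apply: reduced_pushes.
- exact: (pushK (v, b)).
- exact: push_comm.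
Qed.

Definition Pile (y : G) : pile := pushes (repr y) pile0.

Lemma Pile_word w : Pile (raag_word e w) = pushes w pile0.
Proof. by apply: (pushes_congr _ reduced0); apply/raag_wordP/raag_repr. Qed.

Lemma reduced_Pile y : reduced (Pile y).
Proof. exact/reduced_pushes/reduced0. Qed.

Lemma Pile_mul a y : Pile (letg a * y)%g = push a (Pile y).
Proof. by rewrite -{1}(raag_repr y) -raag_word_cons Pile_word. Qed.

(** The diagonal coordinate [(v, v)] records the letters on [v], so each letter of a reduced word is
    counted once. *)
Definition height (p : pile) : nat := \sum_v size (p (v, v)).

Lemma height0 : height pile0 = 0.
Proof. by rewrite /height big1. Qed.

Lemma height_cons a p : height (pcons a p) = (height p).+1.
Proof.
rewrite /height (bigD1 a.1) //= [in RHS](bigD1 a.1) //=.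
rewrite {1}/pcons /supp /= e_irr eqxx /= addSn; congr (_ + _).+1.
apply: eq_bigr => v va; rewrite /pcons /supp /= orbb eq_sym (negbTE va) andbF //.
Qed.

Lemma height_del a p : headed a p -> height p = (height (pdel a p)).+1.
Proof. by move=> H; rewrite -(height_cons a) pdelK. Qed.

Lemma headed_foldr a w : headed a (foldr pcons pile0 w) ->
  exists u1 u2, w = u1 ++ a :: u2 /\ all (fun l => e l.1 a.1) u1.
Proof.
elim: w => [/(_ (a.1, a.1))|l w IH Ha].
  by rewrite /supp /= e_irr eqxx => /(_ isT).
have [<-|la] := eqVneq l a; first by exists [::], w.
have ela : e l.1 a.1.
  apply: contra_notT (elimN eqP la) => nla.
  exact: headed_disj nla (@headed_cons _ _) Ha.
have [u1 [u2 [-> ad]]] : exists u1 u2, w = u1 ++ a :: u2 /\ all (fun l => e l.1 a.1) u1.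
  by apply: IH; apply/(headed_consE _ ela).
by exists (l :: u1), u2; rewrite /= ela.
Qed.

Lemma raag_word_extract a u1 u2 : all (fun l => e l.1 a.1) u1 ->
  raag_word e (u1 ++ a :: u2) = (letg a * raag_word e (u1 ++ u2))%g.
Proof.
elim: u1 => [|l u IH] /=; first by rewrite raag_word_cons.
by case/andP=> la /IH; rewrite !raag_word_cons => ->; rewrite !mulgA letg_comm.
Qed.

Lemma height_pushes w : (height (pushes w pile0) <= size w)%N.
Proof.
elim: w => [|a w IH] /=; first by rewrite height0.
rewrite {1}/push; case: asboolP => [H|_]; last by rewrite height_cons ltnS.
by have := height_del H; lia.
Qed.

(** Cancelling letters as they appear leaves a word whose letters are merely stacked, so that its
    size is the height of the pile. With [height_pushes], the height is the word length. *)
Lemma exists_short_word w :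
  exists2 w', raag_word e w' = raag_word e w & size w' = height (pushes w pile0).
Proof.
suff [w' E1 E2] : exists2 w', raag_word e w' = raag_word e w &
    pushes w pile0 = foldr pcons pile0 w'.
  exists w' => //; rewrite E2; elim: w' {E1 E2} => [|a w' IH] /=; first by rewrite height0.
  by rewrite height_cons IH.
elim: w => [|a w [w' E1 E2]]; first by exists [::].
rewrite /= E2 /push; case: asboolP => [H|_]; last first.
  by exists (a :: w') => //; rewrite !raag_word_cons E1.
have [u1 [u2 [Ew ad]]] := headed_foldr H.
exists (u1 ++ u2).
  by rewrite raag_word_cons -E1 Ew raag_word_extract // letg_linv mulVKg.
rewrite Ew; have -> : foldr pcons pile0 (u1 ++ linv a :: u2) =
    pcons (linv a) (foldr pcons pile0 (u1 ++ u2)).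
  elim: (u1) ad => //= l u IH /andP[la /IH] ->.
  by rewrite pcons_comm.
exact: (pconsK (linv a)).
Qed.

End Letters.

(** * Halfspaces *)

Local Open Scope classical_set_scope.

Section Length.
Variables (V : finType) (e : rel V).
Hypotheses (e_sym : symmetric e) (e_irr : irreflexive e).

Local Notation letter := (V * bool)%type.
Local Notation G := (raag e).
Local Notation letg := (letg e).

Definition ell (y : G) : nat := height (Pile y).

Definition starts (a : letter) (y : G) : bool := `[< headed e a (Pile y) >].

(* Terms [ell x] may differ in the instances inferred for the group law, which
   [lia] does not see through, unlike ssreflect's abstraction. *)
Ltac ell_lia :=
  repeat match goal with H : context [ell _] |- _ => revert H end;
  repeat match goal with |- context [ell ?x] => move: (ell x) => ? end; lia.

Lemma starts1 a : starts a 1%g = false.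
Proof.
apply/negbTE/asboolPn => /(_ (a.1, a.1)).
by rewrite Pile_word // /supp /= e_irr eqxx => /(_ isT).
Qed.

Lemma starts_mul a y : starts a (letg a * y)%g = ~~ starts (linv a) y.
Proof.
rewrite /starts Pile_mul // /push; case: (asboolP (headed e (linv a) _)) => H /=.
  apply/negbTE/asboolPn; have [_] := reduced_del e_sym e_irr (reduced_Pile e_sym e_irr y) H.
  by rewrite linvK.
exact/asboolT/headed_cons.
Qed.

Lemma starts_letg a : starts a (letg a).
Proof. by rewrite -[letg a]mulg1 starts_mul starts1. Qed.

Lemma starts_adj d a y : e d.1 a.1 -> starts a (letg d * y)%g = starts a y.
Proof. by move=> da; rewrite /starts Pile_mul //; apply/asbool_equiv_eq/headed_push. Qed.

Lemma starts_nadj a b y : ~~ e a.1 b.1 -> starts a y -> starts b y -> a = b.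
Proof. by move=> ab /asboolP Ha /asboolP Hb; apply: headed_disj ab Ha Hb. Qed.

Lemma starts_letgE a d : starts d (letg a) -> d = a.
Proof.
move=> da; have [ad|nad] := boolP (e a.1 d.1).
  by move: da; rewrite -[letg a]mulg1 starts_adj // starts1.
by apply: (starts_nadj _ da (starts_letg a)); rewrite e_sym.
Qed.

Lemma ell_mul a y :
  if starts (linv a) y then ell y = (ell (letg a * y)%g).+1
  else ell (letg a * y)%g = (ell y).+1.
Proof.
rewrite /starts /ell Pile_mul // /push; case: asboolP => H; last exact: height_cons.
exact: height_del.
Qed.

Lemma startsE a y : starts a y = (ell ((letg a)^-1 * y)%g < ell y).
Proof.
have := ell_mul (linv a) y; rewrite letg_linv // linvK; case: starts => H; apply/esym.
  by rewrite H ltnSn.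
by rewrite H ltnNge leqnSn.
Qed.

Lemma ell_tail a y : starts a y -> ell y = (ell ((letg a)^-1 * y)%g).+1.
Proof. by have := ell_mul (linv a) y; rewrite letg_linv // linvK => + H; rewrite H. Qed.

Lemma ell_mul_le a y : (ell (letg a * y)%g <= (ell y).+1)%N.
Proof. by have := ell_mul a y; case: starts; ell_lia. Qed.

Lemma short_word y : exists2 w, raag_word e w = y & size w = ell y.
Proof.
have [w E1 E2] := exists_short_word e_sym e_irr (repr y).
by exists w => //; rewrite E1 raag_repr.
Qed.

Lemma ell_word w : (ell (raag_word e w) <= size w)%N.
Proof. by rewrite /ell Pile_word //; apply: height_pushes. Qed.

Lemma ell1 : ell 1%g = 0%N.
Proof. by apply/eqP; rewrite -leqn0; apply: (ell_word [::]). Qed.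

Lemma exists_starts y : y <> 1%g -> exists a, starts a y.
Proof.
have [w E1 E2] := short_word y; case: w E1 E2 => [<- //|a w E1 E2 _].
exists a; rewrite startsE -E2 -E1 raag_word_cons mulKg /=.
by have := ell_word w; ell_lia.
Qed.

Lemma raag_word_inv w : raag_word e (word_inv w) = ((raag_word e w)^-1)%g.
Proof.
apply: (mulgI (raag_word e w)); rewrite mulgV [LHS](raag_word_cat e w).
exact/raag_wordP/word_invK.
Qed.

Lemma ell_inv y : ell (y^-1)%g = ell y.
Proof.
suff H z : (ell (z^-1)%g <= ell z)%N.
  by apply/eqP; rewrite eqn_leq H /= -{1}(invgK y) H.
have [w <- <-] := short_word z; rewrite -raag_word_inv.
by apply: leq_trans (ell_word _) _; rewrite /word_inv size_rev size_map.
Qed.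

Lemma ell_mulr y a : ell (y * letg a)%g = (ell y).+1 \/ ell y = (ell (y * letg a)%g).+1.
Proof.
rewrite -(ell_inv (y * _)%g) invgM -letg_linv // -(ell_inv y).
by have := ell_mul (linv a) (y^-1)%g; case: starts; [right|left].
Qed.

(* Moving [g] along the hyperplane bounding [halfsp g a], or across it, makes it
   longer. *)
Definition irred (g : G) (a : letter) : Prop :=
  forall l, e l.1 a.1 || (l == a) -> (ell g < ell (g * letg l)%g)%N.

(** If $g=dg'$ and $g'l$ were shorter than $g'$, then $|gl|\leq|g'l|+1\leq|g'|<|g|$. *)
Lemma irred_tail g a d : irred g a -> starts d g -> irred ((letg d)^-1 * g)%g a.
Proof.
move=> Hg dg l Hl; have := Hg l Hl; have := ell_tail dg.
have := ell_mulr ((letg d)^-1 * g)%g l.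
have := ell_mul_le d ((letg d)^-1 * g * letg l)%g; rewrite -mulgA mulVKg.
by rewrite mulgA; ell_lia.
Qed.

(** The algebraic form of the inclusion [irred_sub]: multiplication by [y] cannot cancel the first
    letter of [g]. Induction on the length of [g], removing the second letter [d2] first when it
    commutes with [d]. *)
Lemma irred_starts g a d y : irred g a -> starts d g -> starts a y -> starts d (g * y)%g.
Proof.
have [n] := ubnP (ell g); elim: n g d => // n IH g d lt_n Hg dg ay.
have ltail x : starts x g -> (ell ((letg x)^-1 * g)%g < n)%N by move/ell_tail; ell_lia.
pose g' := ((letg d)^-1 * g)%g.
have gE : g = (letg d * g')%g by rewrite mulVKg.
have [g1|/eqP g1] := eqVneq g' 1%g.
  have {}gE : g = letg d by rewrite gE g1 mulg1.
  rewrite gE starts_mul; apply/negP => day.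
  have [da|da] := boolP (e d.1 a.1).
    by have := Hg (linv d); rewrite /= da letg_linv // gE mulgV ell1 => /(_ isT).
  have E : linv d = a by apply: starts_nadj day ay.
  have := Hg a; rewrite eqxx orbT gE -E letg_linv // mulgV ell1 => /(_ isT) //.
have [d2 d2g'] := exists_starts g1.
have d2y : starts d2 (g' * y)%g by apply: IH => //; [exact: ltail|exact: irred_tail].
have [dd2|ndd2] := boolP (e d.1 d2.1).
  have d2g : starts d2 g by rewrite gE starts_adj.
  pose g2 := ((letg d2)^-1 * g)%g.
  have gE2 : g = (letg d2 * g2)%g by rewrite mulVKg.
  have dg2 : starts d g2 by move: dg; rewrite gE2 starts_adj // e_sym.
  rewrite gE2 -mulgA starts_adj; last by rewrite e_sym.
  by apply: IH => //; [exact: ltail|exact: irred_tail].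
(* Otherwise the inverse of [d] starts [g' * y] together with the nonadjacent [d2], so it equals
   [d2] and starts [g'], and [d] could not start [g]. *)
rewrite gE -mulgA starts_mul; apply/negP => Hd.
have E : linv d = d2 by apply: starts_nadj Hd d2y.
by move: dg; rewrite gE starts_mul E d2g'.
Qed.

(** The side of [g * letg a] for the edge from [g] to [g * letg a], by [closer_letg]. *)
Definition halfsp (g : G) (a : letter) : set G := [set z | starts a (g^-1 * z)%g].

Lemma halfspC g a : ~` halfsp g a = halfsp (g * letg a)%g (linv a).
Proof.
apply/funext => z; apply/propext; rewrite /halfsp /setC /=.
rewrite invgM -mulgA -letg_linv // starts_mul linvK.
by split=> /negP.
Qed.

Lemma halfsp_adj g a l : e l.1 a.1 -> halfsp (g * letg l)%g a = halfsp g a.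
Proof.
move=> la; apply/funext => z; rewrite /halfsp /=.
by rewrite invgM -mulgA -letg_linv // starts_adj.
Qed.

Lemma translate_halfsp x g a : [set (x * z)%g | z in halfsp g a] = halfsp (x * g)%g a.
Proof.
apply/seteqP; split=> [_ [z Hz <-]|z Hz]; rewrite /halfsp /= in Hz *.
  by rewrite invgM -mulgA mulKg.
by exists (x^-1 * z)%g; rewrite ?mulVKg // /halfsp /= mulgA -invgM.
Qed.

Lemma halfsp_base g a : ~ halfsp g a g.
Proof. by rewrite /halfsp /= mulVg starts1. Qed.

Lemma halfsp_tip g a : halfsp g a (g * letg a)%g.
Proof. by rewrite /halfsp /= mulKg starts_letg. Qed.

Lemma walk_exword (a b : G) n : walk a b n ->
  exists2 w, b = (a * raag_word e w)%g & size w = n.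
Proof.
case=> p [pp pl <-]; elim: p a pp pl => [|c p IH] a /=.
  by move=> _ <-; exists [::]; rewrite ?mulg1.
case/andP=> /existsP[v Hv] cp pl; have [w -> Ew] := IH c cp pl.
have [l ->] : exists l, c = (a * letg l)%g.
  case/orP: Hv => /eqP Hv; first by exists (v, true).
  by exists (v, false); rewrite -[(v, false)]/(linv (v, true)) letg_linv // Hv mulgK.
by exists (l :: w); rewrite ?raag_word_cons ?mulgA //= Ew.
Qed.

Lemma dist_ell (a b : G) : dist a b = ell (a^-1 * b)%g.
Proof.
rewrite /dist; case: ex_minnP => n /asboolP Hn Hmin; apply/eqP; rewrite eqn_leq.
apply/andP; split.
  have [w Ew <-] := short_word (a^-1 * b)%g; apply/Hmin/asboolP.
  by have := walk_word a w; rewrite Ew mulVKg.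
by have [w -> <-] := walk_exword Hn; rewrite mulKg; apply: ell_word.
Qed.

Lemma closer_letg g a : closer (g * letg a)%g g = halfsp g a.
Proof.
apply/funext => z; apply/propext; rewrite /closer /halfsp /= !dist_ell startsE.
by rewrite -ell_inv -(ell_inv (z^-1 * g)%g) !invgM !invgK -mulgA.
Qed.

Lemma halfspace_labelP (h : set G) v :
  halfspace_label h v <-> exists g b, h = halfsp g (v, b).
Proof.
split=> [[g [->|->]]|[g [[] ->]]].
- exists (g * gen e v)%g, false; rewrite -closer_letg.
  by rewrite -[(v, false)]/(linv (v, true)) letg_linv // mulgK.
- by exists g, true; rewrite -closer_letg.
- by exists g; right; rewrite -closer_letg.
- exists (g * letg (v, false))%g; left; rewrite -closer_letg.
  by rewrite -[(v, false)]/(linv (v, true)) letg_linv // mulgVK.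
Qed.

Lemma halfspaceP (h : set G) : halfspace h <-> exists g a, h = halfsp g a.
Proof.
split=> [[a [b [/existsP[v]]]]|[g [a ->]]].
  case/orP=> /eqP -> ->; last first.
    by exists b, (v, true); rewrite -closer_letg.
  have /halfspace_labelP[g [c ->]] : halfspace_label (closer a (a * gen e v)%g) v.
    by exists a; left.
  by exists g, (v, c).
exists (g * letg a)%g, g; split; last by rewrite closer_letg.
apply/existsP; exists a.1; case: a => v [] /=; first by rewrite eqxx orbT.
by rewrite -[(v, false)]/(linv (v, true)) letg_linv // mulgVK eqxx.
Qed.

Lemma halfspace_has_label (h : set G) : halfspace h -> exists v, halfspace_label h v.
Proof.
by move=> /halfspaceP[g [[v b] ->]]; exists v; apply/halfspace_labelP; exists g, b.
Qed.

(** Descent on the distance from [g0] to [g]: while [irred] fails, some letter moves [g] closer,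
    either along the hyperplane, which keeps the halfspace, or across it, which passes to the
    complement. *)
Lemma irred_rep g0 g a : exists g' a', [/\ a'.1 = a.1,
  halfsp g a = halfsp g' a' \/ halfsp g a = ~` halfsp g' a' &
  irred (g0^-1 * g')%g a'].
Proof.
have [n] := ubnP (ell (g0^-1 * g)%g); elim: n g a => // n IH g a lt_n.
have [Hi|/existsNP[l /not_implyP[Hl Hlt]]] := pselect (irred (g0^-1 * g)%g a).
  by exists g, a; split=> //; left.
have lt_l : (ell (g0^-1 * (g * letg l))%g < n)%N.
  have := ell_mulr (g0^-1 * g)%g l; rewrite -mulgA; move: Hlt; rewrite -mulgA; ell_lia.
case/orP: Hl => [la|/eqP E].
  have [g' [a' [E1 E2 E3]]] := IH _ a lt_l.
  by exists g', a'; rewrite -(halfsp_adj g la).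
rewrite {}E in lt_l.
have [g' [a' [E1 E2 E3]]] := IH _ (linv a) lt_l.
exists g', a'; split=> //; rewrite -(setCK (halfsp g a)) halfspC.
by case: E2 => ->; [right|left; rewrite setCK].
Qed.

Lemma irred_sub g0 g a d : irred (g0^-1 * g)%g a -> starts d (g0^-1 * g)%g ->
  halfsp g a `<=` halfsp g0 d.
Proof.
move=> Hi dg z az; rewrite /halfsp /=.
by have := irred_starts Hi dg az; rewrite -mulgA mulVKg.
Qed.

(** * Labels of transverse and of tightly nested halfspaces *)

Definition transverse (h k : set G) : Prop :=
  [/\ exists z, h z /\ k z, exists z, h z /\ ~ k z,
      exists z, ~ h z /\ k z & exists z, ~ h z /\ ~ k z].

Lemma transverseC h k : transverse (~` h) k -> transverse h k.
Proof.
case=> -[z1 [/= A1 B1]] [z2 [/= A2 B2]] [z3 [/= A3 B3]] [z4 [/= A4 B4]]; split.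
- by exists z3; split=> //; apply: contrapT.
- by exists z4; split=> //; apply: contrapT.
- by exists z1.
- by exists z2.
Qed.

(** Induction on the distance from [g0] to [g]; let [d] start the way. If [d] is adjacent to [c],
    move [g0] along the hyperplane of [c]. Otherwise [halfsp g0 d] contains [halfsp g a] and is
    equal to or disjoint from [halfsp g0 c]. *)
Lemma irred_not_transverse g0 g a c : irred (g0^-1 * g)%g a -> ~~ e a.1 c.1 ->
  ~ transverse (halfsp g a) (halfsp g0 c).
Proof.
have [n] := ubnP (ell (g0^-1 * g)%g); elim: n g0 => // n IH g0 lt_n Hi nac.
have [g1|/eqP g1] := eqVneq (g0^-1 * g)%g 1%g.
  have -> : g = g0 by rewrite -[RHS]mulg1 -g1 mulVKg.
  case=> -[z [az cz]] [z' [az' cz']] _ _; apply: cz'; move: az az'.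
  by rewrite /halfsp /= => az; rewrite (starts_nadj nac az cz).
have [d dg] := exists_starts g1; have sub := irred_sub Hi dg.
have [dc|ndc] := boolP (e d.1 c.1).
  rewrite -(halfsp_adj g0 dc).
  have E : ((g0 * letg d)^-1 * g)%g = ((letg d)^-1 * (g0^-1 * g))%g.
    by rewrite invgM mulgA.
  apply: IH => //; rewrite E; last exact: irred_tail.
  by move/ell_tail: dg; ell_lia.
case=> -[z [/sub az cz]] [z' [/sub az' cz']] _ _; apply: cz'.
by move: az'; rewrite (starts_nadj ndc az cz).
Qed.

Lemma not_transverse (h k : set G) v w : ~~ e v w -> halfspace_label h v -> halfspace_label k w ->
  ~ transverse h k.
Proof.
move=> nvw /halfspace_labelP[g [b ->]] /halfspace_labelP[g0 [c ->]].
have [g' [a' [E1 E2 E3]]] := irred_rep g0 g (v, b).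
have := @irred_not_transverse g0 g' a' (w, c) E3; rewrite E1 => /(_ nvw) H.
by case: E2 => -> // /transverseC.
Qed.

(** Same induction as for [irred_not_transverse]. It stops before [g0] reaches [g], because adjacent
    letters at one vertex give intersecting halfspaces; at the first [d] not adjacent to [c], the
    halfspace [halfsp g0 d] lies in between. *)
Lemma irred_between g0 g a c k : irred (g0^-1 * g)%g a -> e a.1 c.1 ->
  k = halfsp g a \/ k = ~` halfsp g a -> k `&` halfsp g0 c = set0 ->
  exists h', [/\ halfspace h', h' <> ~` halfsp g0 c, h' <> k, k `<=` h' &
                 h' `<=` ~` halfsp g0 c].
Proof.
move=> + ac kE; have [n] := ubnP (ell (g0^-1 * g)%g).
elim: n g0 => // n IH g0 lt_n Hi k0.
have ca : e c.1 a.1 by rewrite e_sym.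
have [g1|/eqP g1] := eqVneq (g0^-1 * g)%g 1%g.
  have gE : g = g0 by rewrite -[RHS]mulg1 -g1 mulVKg.
  exfalso; case: kE => E.
    suff : (k `&` halfsp g0 c) (g0 * (letg a * letg c))%g by rewrite k0.
    rewrite E gE; split; rewrite /halfsp /= mulKg; last by rewrite starts_adj // starts_letg.
    by rewrite starts_mul -[letg c]mulg1 starts_adj // starts1.
  suff : (k `&` halfsp g0 c) (g0 * letg c)%g by rewrite k0.
  rewrite E gE; split; last exact: halfsp_tip.
  rewrite /halfsp /= mulKg -[letg c]mulg1 starts_adj // starts1 //.
have [d dg] := exists_starts g1; have sub := irred_sub Hi dg.
have [dc|ndc] := boolP (e d.1 c.1).
  have E : ((g0 * letg d)^-1 * g)%g = ((letg d)^-1 * (g0^-1 * g))%g.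
    by rewrite invgM mulgA.
  have := IH (g0 * letg d)%g; rewrite halfsp_adj // E; apply=> //; last exact: irred_tail.
  by move/ell_tail: dg; ell_lia.
have gd : halfsp g0 d g by [].
have gna := @halfsp_base g a.
have tip := halfsp_tip g0 c.
have kc : ~ k (g0 * letg c)%g.
  move=> kc; suff : (k `&` halfsp g0 c) (g0 * letg c)%g by rewrite k0.
  by split.
(* The complement is excluded: [halfsp g a] would contain the tip of [c], forcing [d = c], and then
   [g] would lie in both disjoint sets. *)
case: kE => kE; last first.
  exfalso; have ga : halfsp g a (g0 * letg c)%g.
    by apply: contrapT => ?; apply: kc; rewrite kE.
  have dE : d = c.
    by apply: (starts_nadj ndc (sub _ ga)); apply: tip.
  suff : (k `&` halfsp g0 c) g by rewrite k0.
  by rewrite kE -dE.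
have nE : d <> c.
  move=> E; suff : (k `&` halfsp g0 c) (g * letg a)%g by rewrite k0.
  rewrite kE -E; split; [exact: halfsp_tip|exact/sub/halfsp_tip].
exists (halfsp g0 d); split.
- by apply/halfspaceP; exists g0, d.
- move=> E; have : (~` halfsp g0 c) g0 by exact: halfsp_base.
  by rewrite -E; apply: halfsp_base.
- by move=> E; apply: gna; rewrite -kE -E.
- by rewrite kE.
- by move=> z dz cz; apply: nE; apply: starts_nadj ndc dz cz.
Qed.

Lemma tightly_nested_nadj (h k : set G) v w : tightly_nested h k ->
  halfspace_label h w -> halfspace_label k v -> ~~ e v w.
Proof.
move=> [[kh nhk] tight] /halfspace_labelP[g0 [b hE]] /halfspace_labelP[g [b' kE]].
apply/negP => vw; apply: tight.
pose c : letter := linv (w, b); pose g1 := (g0 * letg (w, b))%g.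
(* With [h] written as a complement, the nesting becomes the disjointness required by
   [irred_between]. *)
have {}hE : h = ~` halfsp g1 c by rewrite -halfspC setCK.
have [g' [a' [E1 E2 E3]]] := irred_rep g1 g (v, b').
have ac : e a'.1 c.1 by rewrite E1.
have k0 : k `&` halfsp g1 c = set0.
  by apply/seteqP; split=> // z [/kh]; rewrite hE => nz /nz.
rewrite -kE in E2; have [h' [H1 H2 H3 H4 H5]] := irred_between E3 ac E2 k0.
by exists h'; rewrite hE; split=> //; apply/eqP.
Qed.

(** An edge crosses one hyperplane only. With [g'] irreducible from [z], a nontrivial way from [z]
    to [g'] would start with [l], and its tail would violate [irred]; the complementary orientation
    is impossible. *)
Lemma halfsp_cross g a z l : halfsp g a (z * letg l)%g -> ~ halfsp g a z ->
  halfsp g a = halfsp z l.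
Proof.
have [g' [a' [_ E2 E3]]] := irred_rep z g a.
set y := (z^-1 * g')%g in E3.
have gE : g' = (z * y)%g by rewrite mulVKg.
have starts_l d : y <> 1%g -> starts d y -> starts a' (y^-1 * letg l)%g -> d = l.
  move=> _ dy /(irred_starts E3 dy); rewrite mulVKg; exact: starts_letgE.
case: E2 => ->; rewrite /halfsp /= gE invgM -!mulgA ?mulKg ?mulVg ?mulg1 => H1 H2.
  have [y1|/eqP y1] := eqVneq y 1%g.
    by move: H1; rewrite y1 invg1 !mul1g => /starts_letgE ->.
  have [d dy] := exists_starts y1.
  have dl := starts_l d y1 dy H1.
  have ly : starts l y by rewrite -dl.
  have := irred_tail E3 ly; move=> /(_ a'); rewrite eqxx orbT => /(_ isT).
  move: H1; rewrite startsE -ell_inv -(ell_inv (y^-1 * _)%g) !invgM !invgK; ell_lia.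
have [y1|/eqP y1] := eqVneq y 1%g.
  by exfalso; apply: H2; rewrite y1 invg1 starts1.
have [d dy] := exists_starts y1; have {}H2 : starts a' (y^-1)%g by apply: contrapT.
by have := irred_starts E3 dy H2; rewrite mulgV starts1.
Qed.

Lemma separating_finite (x y : G) :
  exists L : seq (set G), forall h, separating x y h -> h \in L.
Proof.
have [w <-] : exists w, (x * raag_word e w)%g = y.
  by exists (repr (x^-1 * y)%g); rewrite raag_repr mulVKg.
elim: w x => [|l w IH] x.
  by exists [::] => h []; rewrite mulg1.
have [L HL] := IH (x * letg l)%g.
exists (halfsp x l :: L) => h [hh hy hx]; rewrite in_cons.
have [hxl|nhxl] := pselect (h (x * letg l)%g).
  have /halfspaceP[g [a E]] := hh.
  by rewrite E in hxl hx *; rewrite (halfsp_cross hxl hx) eqxx.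
apply/orP; right; apply: HL; split=> //.
by rewrite -mulgA -raag_word_cons.
Qed.

End Length.

(** * Translates of a segment *)

Section Covered.
Variable X : eqType.

Definition covered n (A : set X) : Prop :=
  exists L : seq X, (size L <= n)%N /\ forall t, A t -> t \in L.

Lemma covered_sub n (A B : set X) : A `<=` B -> covered n B -> covered n A.
Proof. by move=> AB [L [sL HL]]; exists L; split=> // t /AB/HL. Qed.

Lemma covered_setU m n (A B : set X) :
  covered m A -> covered n B -> covered (m + n) (A `|` B).
Proof.
move=> [L [sL HL]] [K [sK HK]]; exists (L ++ K); rewrite size_cat; split; first by lia.
by move=> t [/HL|/HK]; rewrite mem_cat => ->; rewrite ?orbT.
Qed.

Lemma covered_bigcup (I : eqType) (l : seq I) n (A : I -> set X) :
  (forall i, covered n (A i)) ->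
  covered (size l * n) [set t | exists2 i, i \in l & A i t].
Proof.
move=> HA; elim: l => [|i l IH]; first by exists [::]; split=> // t [].
apply: covered_sub (covered_setU (HA i) IH) => t [j].
by rewrite inE => /orP[/eqP ->|jl] Aj; [left|right; exists j].
Qed.

Lemma covered_inj (Y : eqType) (f : X -> Y) n (A : set X) (L : seq Y) :
  (size L <= n)%N -> (forall t, A t -> f t \in L) ->
  (forall t t', A t -> A t' -> f t = f t' -> t = t') -> covered n A.
Proof.
move=> sL fL f_inj.
(* A partial inverse of [f] on [A], obtained by choice. *)
pose g y := if pselect (exists t, A t /\ f t = y) is left E
  then Some (sval (cid E)) else None.
exists (pmap g L); split.
  by rewrite size_pmap; apply: leq_trans (count_size _ _) sL.
move=> t At; rewrite mem_pmap; apply/mapP; exists (f t); first exact: fL.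
rewrite /g; case: pselect => [E|[]]; last by exists t.
by case: (cid E) => t' [At' ft'] /=; congr Some; apply: f_inj.
Qed.

End Covered.

(** * Chains of translates in an interval *)

Section Segments.
Variables (V : finType) (e : rel V).
Hypotheses (e_sym : symmetric e) (e_irr : irreflexive e).

Local Notation G := (raag e).
Implicit Types (x y z g : G) (h k : set G) (s t : seq (set G)).

Local Notation act g h := [set (g * z)%g | z in h].

Lemma actE g h z : act g h z = h (g^-1 * z)%g.
Proof.
apply/propext; split=> [[y hy <-]|hz]; first by rewrite mulKg.
by exists (g^-1 * z)%g; rewrite ?mulVKg.
Qed.

Lemma actM g g' h : act g (act g' h) = act (g * g')%g h.
Proof. by apply/funext => z; rewrite !actE invgM mulgA. Qed.

Lemma act1 h : act 1%g h = h.
Proof. by apply/funext => z; rewrite actE invg1 mul1g. Qed.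

Lemma act_subset g h k : h `<=` k -> act g h `<=` act g k.
Proof. by move=> hk z; rewrite !actE => /hk. Qed.

Lemma act_inj g : injective (fun h => act g h).
Proof. by move=> h k E; rewrite -[h]act1 -[k]act1 -(mulVg g) -!actM E. Qed.

Lemma halfspace_act g h : halfspace h -> halfspace (act g h).
Proof.
move=> /(halfspaceP e_sym e_irr)[g' [a ->]]; apply/halfspaceP => //.
by exists (g * g')%g, a; rewrite translate_halfsp.
Qed.

Lemma label_act g h v : halfspace_label h v -> halfspace_label (act g h) v.
Proof.
move=> /(halfspace_labelP e_sym e_irr)[g' [b ->]]; apply/halfspace_labelP => //.
by exists (g * g')%g, b; rewrite translate_halfsp.
Qed.

Lemma tightly_nested_act g h k : tightly_nested h k -> tightly_nested (act g h) (act g k).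
Proof.
move=> [[kh nhk] tight]; split.
  split; first exact: act_subset.
  move=> /(act_subset (g := g^-1%g)); rewrite !actM mulVg !act1; exact: nhk.
move=> [h' [H1 /eqP H2 /eqP H3 H4 H5]]; apply: tight.
have E : act g (act g^-1%g h') = h' by rewrite actM mulgV act1.
exists (act g^-1%g h'); split.
- exact: halfspace_act.
- by apply/eqP => E'; apply: H2; rewrite -E E'.
- by apply/eqP => E'; apply: H3; rewrite -E E'.
- by move/(act_subset (g := g^-1%g)): H4; rewrite actM mulVg act1.
- by move/(act_subset (g := g^-1%g)): H5; rewrite actM mulVg act1.
Qed.

Lemma translateM g g' s : translate g (translate g' s) = translate (g * g')%g s.
Proof. by rewrite /translate -map_comp; apply: eq_map => h /=; rewrite actM. Qed.

Lemma translate1 s : translate 1%g s = s.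
Proof. by rewrite /translate -[RHS]map_id; apply: eq_map => h; rewrite act1. Qed.

Lemma Hsegment_translate g s : Hsegment s -> Hsegment (translate g s).
Proof.
case=> s0 sh /(sortedP set0) st; split.
- by case: (s) s0.
- by move=> h /mapP[k /sh hk ->]; apply: halfspace_act.
- apply/(sortedP set0) => i; rewrite size_map => Hi.
  rewrite !(nth_map set0) //; last exact: ltnW.
  by apply/asboolP/tightly_nested_act/asboolP/st.
Qed.

Variable s : seq (set G).
Hypothesis s_seg : Hsegment s.

Definition is_translate t : Prop := exists g, t = translate g s.

Lemma is_translate_seg t : is_translate t -> Hsegment t.
Proof. by move=> [g ->]; apply: Hsegment_translate. Qed.

Lemma size_is_translate t : is_translate t -> size t = size s.
Proof. by move=> [g ->]; rewrite size_map. Qed.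

Lemma size_s_gt0 : (0 < size s)%N.
Proof. by case: s_seg; case: (s). Qed.

Lemma label_nth i : (i < size s)%N ->
  exists v, forall t, is_translate t -> halfspace_label (nth set0 t i) v.
Proof.
move=> Hi; have [_ /(_ _ (mem_nth set0 Hi)) Hh _] := s_seg.
have [v Hv] := halfspace_has_label e_sym e_irr Hh.
by exists v => t [g ->]; rewrite (nth_map set0) //; apply: label_act.
Qed.

Lemma tight_nth t i : is_translate t -> (i.+1 < size s)%N ->
  tightly_nested (nth set0 t i) (nth set0 t i.+1).
Proof.
move=> Ht Hi; have [_ _ /(sortedP set0) H] := is_translate_seg Ht.
by apply/asboolP/H; rewrite size_is_translate.
Qed.

Lemma nth_subset t i j : is_translate t -> (i <= j < size s)%N ->
  nth set0 t j `<=` nth set0 t i.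
Proof.
move=> Ht; elim: j => [|j IH]; first by rewrite leqn0 => /andP[/eqP -> _].
rewrite leq_eqVlt => /andP[/predU1P[-> _ //|ij] Hj].
apply: subset_trans (IH _); last by rewrite -ltnS ij ltnW.
by have [[]] := tight_nth Ht Hj.
Qed.

(** The halfspaces of [t] are nested, so the first one decides about [x] and the last one about
    [y]. *)
Lemma translates_inP x y t :
  translates_in s x y t <-> [/\ is_translate t, ~ head set0 t x & last set0 t y].
Proof.
split=> [[Ht H]|[Ht hx ly]].
have t0 : (0 < size t)%N by rewrite (size_is_translate Ht) size_s_gt0.
  split=> //.
    by have [] := H (head set0 t) _; rewrite -?nth0 //; apply: mem_nth.
  by have [] := H (last set0 t) _; rewrite -?nth_last //; apply: mem_nth; rewrite ltn_predL.
split=> // h /(nthP set0)[i Hi <-]; rewrite size_is_translate // in Hi.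
split.
- by have [_ + _] := is_translate_seg Ht; apply; apply: mem_nth; rewrite size_is_translate.
- move: ly; rewrite -nth_last size_is_translate //.
  by apply: (nth_subset Ht); have := size_s_gt0; lia.
- by move=> H; apply: hx; rewrite -nth0; apply: (nth_subset Ht _ H); lia.
Qed.

Lemma nth_sep x y t i : translates_in s x y t -> (i < size s)%N ->
  ~ nth set0 t i x /\ nth set0 t i y.
Proof.
move=> [Ht H] Hi; have [] := H (nth set0 t i) _; last by split.
by apply: mem_nth; rewrite size_is_translate.
Qed.

Lemma not_transverse_nested h k x y : ~ transverse h k -> ~ h x -> ~ k x -> h y -> k y ->
  h `<=` k \/ k `<=` h.
Proof.
move=> nT hx kx hy ky; apply: contrapT => /not_orP[/existsNP[z1 /not_implyP[A1 B1]]].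
move=> /existsNP[z2 /not_implyP[A2 B2]]; apply: nT; split.
- by exists y.
- by exists z1.
- by exists z2.
- by exists x.
Qed.

Lemma nested_nth x y t t' i j v w : translates_in s x y t -> translates_in s x y t' ->
  (i < size s)%N -> (j < size s)%N ->
  halfspace_label (nth set0 t i) v -> halfspace_label (nth set0 t' j) w -> ~~ e v w ->
  nth set0 t i `<=` nth set0 t' j \/ nth set0 t' j `<=` nth set0 t i.
Proof.
move=> Ht Ht' Hi Hj lv lw nvw.
have [ax ay] := nth_sep Ht Hi; have [bx by_] := nth_sep Ht' Hj.
exact: not_transverse_nested (not_transverse e_sym e_irr nvw lv lw) ax bx ay by_.
Qed.

Lemma nested_same x y t t' i : translates_in s x y t -> translates_in s x y t' ->
  (i < size s)%N -> ~ (nth set0 t' i `<` nth set0 t i) -> nth set0 t i `<=` nth set0 t' i.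
Proof.
move=> Ht Ht' Hi nlt; have [v lv] := label_nth Hi.
have [//|H] := nested_nth Ht Ht' Hi Hi (lv _ Ht.1) (lv _ Ht'.1) (negbT (e_irr v)).
by apply: contrapT => H'; apply: nlt.
Qed.

Lemma label_nth_nadj t i v w : is_translate t -> (i.+1 < size s)%N ->
  halfspace_label (nth set0 t i) v -> halfspace_label (nth set0 t i.+1) w -> ~~ e v w.
Proof.
by move=> Ht Hi lv lw; rewrite e_sym; apply: tightly_nested_nadj (tight_nth Ht Hi) lv lw.
Qed.

Lemma tight_squeeze h k h' : tightly_nested h k -> halfspace h' ->
  k `<=` h' -> h' `<=` h -> h' = h \/ h' = k.
Proof.
move=> [_ T] hh' kh' h'h; apply: contrapT => /not_orP[/eqP n1 /eqP n2].
by apply: T; exists h'.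
Qed.

Lemma nth_halfspace t i : is_translate t -> (i < size s)%N -> halfspace (nth set0 t i).
Proof.
move=> Ht Hi; have [_ + _] := is_translate_seg Ht.
by apply; apply: mem_nth; rewrite size_is_translate.
Qed.

(** If the inclusion failed at [i.+1], then $t_{i+1}\subseteq t'_{i+1}\subset t'_i\subset t_i$;
    tightness of [t] would force $t'_i=t_{i+1}$, which strictly contains $t'_{i+1}$. The converse
    uses tightness of [t']. *)
Lemma strict_next x y t t' i : translates_in s x y t -> translates_in s x y t' ->
  (i.+1 < size s)%N ->
  nth set0 t' i `<` nth set0 t i <-> nth set0 t' i.+1 `<` nth set0 t i.+1.
Proof.
move=> Ht Ht' Hi; split=> lt1; apply: contrapT => nlt.
  have le2 := nested_same Ht Ht' Hi nlt.
  have [[le3 _] _] := tight_nth Ht'.1 Hi.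
  have [E|E] := tight_squeeze (tight_nth Ht.1 Hi) (nth_halfspace Ht'.1 (ltnW Hi))
    (subset_trans le2 le3) (properW lt1).
    by move: lt1; rewrite E => -[_]; apply.
  by apply: nlt; rewrite -E; have [] := tight_nth Ht'.1 Hi.
have le2 := nested_same Ht Ht' (ltnW Hi) nlt.
have [[le3 _] _] := tight_nth Ht.1 Hi.
have [E|E] := tight_squeeze (tight_nth Ht'.1 Hi) (nth_halfspace Ht.1 Hi)
  (properW lt1) (subset_trans le3 le2).
  by have [[_ +] _] := tight_nth Ht.1 Hi; apply; rewrite E.
by move: lt1; rewrite E => -[_]; apply.
Qed.

Lemma strict_all x y t t' i j : translates_in s x y t -> translates_in s x y t' ->
  (i < size s)%N -> (j < size s)%N ->
  nth set0 t' i `<` nth set0 t i -> nth set0 t' j `<` nth set0 t j.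
Proof.
move=> Ht Ht' Hi Hj lt1.
have {}lt1 : nth set0 t' 0 `<` nth set0 t 0.
  by elim: i Hi lt1 => // i IH Hi /(strict_next Ht Ht' Hi); apply: IH; apply: ltnW.
elim: j Hj => // j IH Hj; apply/(strict_next Ht Ht' Hj); apply: IH; exact: ltnW.
Qed.

(** Halfspaces at the same position have the same label, hence are nested, and a strict inclusion at
    one position spreads to all by [strict_all]. *)
Lemma translates_in_total x y t t' : translates_in s x y t -> translates_in s x y t' ->
  t <> t' ->
  (forall i, (i < size s)%N -> nth set0 t' i `<` nth set0 t i) \/
  (forall i, (i < size s)%N -> nth set0 t i `<` nth set0 t' i).
Proof.
move=> Ht Ht' tt'.
have [i Hi ne] : exists2 i, (i < size s)%N & nth set0 t i <> nth set0 t' i.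
  apply: contrapT => H; apply: tt'; apply: (@eq_from_nth _ set0).
    by rewrite !size_is_translate ?Ht.1 ?Ht'.1 //; [exact: Ht'.1|exact: Ht.1].
  move=> i Hi; apply: contrapT => ne; apply: H; exists i => //.
  by rewrite size_is_translate in Hi; last exact: Ht.1.
have [lt1|nlt1] := pselect (nth set0 t' i `<` nth set0 t i).
  by left=> j Hj; apply: (strict_all Ht Ht' Hi).
have [lt2|nlt2] := pselect (nth set0 t i `<` nth set0 t' i).
  by right=> j Hj; apply: (strict_all Ht' Ht Hi).
exfalso; apply: ne; apply/seteqP; split.
  exact: nested_same Ht Ht' Hi nlt1.
exact: nested_same Ht' Ht Hi nlt2.
Qed.

Lemma translates_in_nth_inj i x y t t' : (i < size s)%N ->
  translates_in s x y t -> translates_in s x y t' ->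
  nth set0 t i = nth set0 t' i -> t = t'.
Proof.
move=> Hi Ht Ht' E; apply: contrapT => /(translates_in_total Ht Ht')[] /(_ i Hi);
  by rewrite E => -[_]; apply.
Qed.

Lemma head_inj x y t t' : translates_in s x y t -> translates_in s x y t' ->
  head set0 t = head set0 t' -> t = t'.
Proof.
by move=> Ht Ht'; rewrite -!nth0; apply: (translates_in_nth_inj size_s_gt0 Ht Ht').
Qed.

Lemma last_inj x y t t' : translates_in s x y t -> translates_in s x y t' ->
  last set0 t = last set0 t' -> t = t'.
Proof.
move=> Ht Ht'; rewrite -!nth_last (size_is_translate Ht.1) (size_is_translate Ht'.1).
by apply: (translates_in_nth_inj _ Ht Ht'); rewrite ltn_predL size_s_gt0.
Qed.

(** Consecutive labels are nonadjacent, so $t'_i$ and $t_{i+1}$ are comparable; if $t_{i+1}\subseteq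
    t'_i\subsetneq t_i$, tightness leaves only equality. *)
Lemma strict_shift x y t t' i : translates_in s x y t -> translates_in s x y t' ->
  (i.+1 < size s)%N -> nth set0 t' i `<` nth set0 t i -> nth set0 t' i `<=` nth set0 t i.+1.
Proof.
move=> Ht Ht' Hi lt1; have [v lv] := label_nth (ltnW Hi); have [w lw] := label_nth Hi.
have nvw := label_nth_nadj Ht.1 Hi (lv _ Ht.1) (lw _ Ht.1).
have [//|le] := nested_nth Ht' Ht (ltnW Hi) Hi (lv _ Ht'.1) (lw _ Ht.1) nvw.
have [E|->//] := tight_squeeze (tight_nth Ht.1 Hi) (nth_halfspace Ht'.1 (ltnW Hi))
    le (properW lt1).
by move: lt1; rewrite E => -[_ []].
Qed.

(* Each such translate is determined by the position at which [y] leaves it. *)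
Lemma covered_crossing x y z :
  covered (size s) [set t | [/\ translates_in s x z t, head set0 t y & ~ last set0 t y]].
Proof.
pose f t := find (fun h : set G => ~~ `[< h y >]) t.
have Hf t : translates_in s x z t -> ~ last set0 t y ->
    (f t < size s)%N /\ ~ nth set0 t (f t) y.
  move=> Ht ly; have St := size_is_translate Ht.1.
  have Hh : has (fun h : set G => ~~ `[< h y >]) t.
    apply/hasP; exists (last set0 t); last exact/asboolPn.
    by rewrite -nth_last; apply: mem_nth; rewrite St ltn_predL size_s_gt0.
  split; first by rewrite -St -has_find.
  by apply/asboolPn; apply: (nth_find set0 Hh).
have disj t t' : translates_in s x z t -> translates_in s x z t' -> head set0 t y ->
    ~ last set0 t y -> ~ last set0 t' y ->
    (forall i, (i < size s)%N -> nth set0 t' i `<` nth set0 t i) -> f t <> f t'.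
  move=> Ht Ht' hy ly ly' lt1 E.
  have [f1 f2] := Hf t Ht ly; have [f1' f2'] := Hf t' Ht' ly'.
  (* If [y] leaves both at position $j+1$, it lies in $t'_j\subseteq t_{j+1}$, a contradiction;
     position 0 is excluded because [y] lies in the head. *)
  case Ef: (f t) => [|j]; first by apply: f2; rewrite Ef nth0.
  rewrite {}Ef in E f1 f2; apply: f2.
  apply: (strict_shift Ht Ht' f1 (lt1 _ (ltnW f1))).
  have : (j < f t')%N by rewrite -E.
  by move=> /(before_find set0)/negbFE/asboolP.
apply: (covered_inj (f := f) (L := iota 0 (size s))); first by rewrite size_iota.
  by move=> t [Ht hy ly]; rewrite mem_iota /= add0n; have [] := Hf t Ht ly.
move=> t t' [Ht hy ly] [Ht' hy' ly'] E; apply: contrapT.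
move=> /(translates_in_total Ht Ht')[] H.
  exact: disj Ht Ht' hy ly ly' H E.
exact: disj Ht' Ht hy' ly' ly H (esym E).
Qed.

Lemma translates_in_finite x y : exists n, covered n (translates_in s x y).
Proof.
have [L HL] := separating_finite e_sym e_irr x y; exists (size L).
apply: (covered_inj (f := head set0) (L := L)) => //; last exact: head_inj.
move=> t [Ht H]; apply/HL/H; rewrite -nth0; apply: mem_nth.
by rewrite size_is_translate // size_s_gt0.
Qed.

Definition between t : set (set G) :=
  [set h | [/\ halfspace h, last set0 t `<=` h & h `<=` head set0 t]].

(** The bound is uniform because translation carries [between s] to [between t], and the halfspaces
    of the former separate two fixed points. *)
Lemma covered_between :
  exists n, forall t, is_translate t -> covered n (between t).
Proof.
have Hhead : halfspace (head set0 s).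
  rewrite -nth0; apply: nth_halfspace size_s_gt0; exists 1%g; rewrite translate1 //.
have Hlast : halfspace (last set0 s).
  rewrite -nth_last; apply: nth_halfspace; last by have := size_s_gt0; lia.
  by exists 1%g; rewrite translate1.
have [x hx] : exists x, ~ head set0 s x.
  have [g [a ->]] := (halfspaceP e_sym e_irr _).1 Hhead.
  by exists g; apply: halfsp_base.
have [y ly] : exists y, last set0 s y.
  have [g [a ->]] := (halfspaceP e_sym e_irr _).1 Hlast.
  by exists (g * letg e a)%g; apply: halfsp_tip.
have [L HL] := separating_finite e_sym e_irr x y.
exists (size L) => t [g ->].
apply: (covered_inj (f := fun h => act g^-1%g h) (L := L)) => //; last first.
  by move=> h k _ _; apply: act_inj.
have [s0 _ _] := s_seg.
have E1 : head set0 (translate g s) = act g (head set0 s) by case: (s) s0.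
have E2 : last set0 (translate g s) = act g (last set0 s).
  by case: (s) s0 => //= h s' _; apply: (last_map (fun k => act g k)).
move=> h [hh]; rewrite E1 E2 => lh hh'; apply: HL; split.
- exact: halfspace_act.
- by rewrite actE invgK; apply: lh; rewrite actE mulKg.
- by rewrite actE invgK => /hh'; rewrite actE mulKg.
Qed.

Lemma translates_in_act g x y t :
  translates_in s (g * x)%g (g * y)%g (translate g t) <-> translates_in s x y t.
Proof.
suff H g' x' y' t' : translates_in s x' y' t' ->
    translates_in s (g' * x')%g (g' * y')%g (translate g' t').
  split; last exact: H.
  by move/(H g^-1%g); rewrite !mulKg translateM mulVg translate1.
move=> [[g0 ->] H]; split; first by exists (g' * g0)%g; rewrite translateM.
move=> h /mapP[k /H[h1 h2 h3] ->]; split; first exact: halfspace_act.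
  by rewrite actE mulKg.
by rewrite actE mulKg.
Qed.

End Segments.

(** * The correction term of a pair of translates *)

Import Order.TTheory GRing.Theory Num.Theory.
Local Open Scope ring_scope.

(* The position of a point with respect to a segment $(h_1\supset\dots\supset h_l)$:
   whether it lies in $h_1$ and whether it lies in $h_l$. *)
Definition zone := (bool * bool)%type.

(** The pair [(false, true)] does not occur, as $h_l\subseteq h_1$. *)
Definition zones : seq zone := [:: (false, false); (true, false); (true, true)].

(* The contribution of a translate to $f_s(x,y)$, for [x] in zone [p] and [y] in
   zone [q]. *)
Definition dir (p q : zone) : int := (~~ p.1 && q.2)%:Z - (~~ q.1 && p.2)%:Z.

(** The contribution of a translate to $\delta f_s$. *)
Definition turn (p q r : zone) : int := dir q r - dir p r + dir p q.

(** The contribution to $f_s(x,m)$ for the median $m$: a halfspace contains $m$ when it contains two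
    of the three points, so for $x\notin h_1$ the median is in $h_l$ exactly when both other points
    are. *)
Definition overlap (p q r : zone) : int :=
  (~~ p.1 && q.2 && (~~ p.1 && r.2))%:Z - (~~ q.1 && p.2 && (~~ r.1 && p.2))%:Z.

(* The term of a pair $(t,u)$ in $f_s\cup\omega+\delta\eta$, when the four points
   lie in the zones [a] of $t$ and [b] of $u$. *)
Definition corr (a b : seq zone) : int :=
  let a := nth (false, false) a in let b := nth (false, false) b in
  dir (a 0%N) (a 1%N) * turn (b 1%N) (b 2%N) (b 3%N)
  + (overlap (a 1%N) (a 2%N) (a 3%N) * turn (b 1%N) (b 2%N) (b 3%N)
     - overlap (a 0%N) (a 2%N) (a 3%N) * turn (b 0%N) (b 2%N) (b 3%N)
     + overlap (a 0%N) (a 1%N) (a 3%N) * turn (b 0%N) (b 1%N) (b 3%N)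
     - overlap (a 0%N) (a 1%N) (a 2%N) * turn (b 0%N) (b 1%N) (b 2%N)).

(** * Configurations of four points relative to two segments *)

Section Patterns.
Variable T : Type.
Implicit Types (f k : T -> bool) (z : T -> zone) (c : seq T).

Definition crossb f k c : bool :=
  [&& has (fun p => f p && k p) c, has (fun p => f p && ~~ k p) c,
      has (fun p => ~~ f p && k p) c & has (fun p => ~~ f p && ~~ k p) c].

Definition hits3 z c : bool :=
  [&& has (fun p => ~~ (z p).1) c, has (fun p => (z p).1 && ~~ (z p).2) c
    & has (fun p => (z p).2) c].

Definition hits2 z c : bool :=
  has (fun p => ~~ (z p).1) c && has (fun p => (z p).2) c.

(** Given nontransversality, these witnesses force the halfspace of [f] or its complement to lie
    between the last and first halfspaces of the segment, see [between_pattern]. *)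
Definition betweenb f z c : bool :=
  [&& has (fun p => (z p).1 && ~~ (z p).2 && f p) c,
      has (fun p => (z p).1 && ~~ (z p).2 && ~~ f p) c
    & has (fun p => ~~ (z p).1 && ~~ f p) c && has (fun p => (z p).2 && f p) c
      || has (fun p => ~~ (z p).1 && f p) c && has (fun p => (z p).2 && ~~ f p) c].

Definition nocross (a b : T -> zone) c : bool :=
  [&& ~~ crossb (fun p => (a p).1) (fun p => (b p).1) c,
      ~~ crossb (fun p => (a p).1) (fun p => (b p).2) c,
      ~~ crossb (fun p => (a p).2) (fun p => (b p).1) c
    & ~~ crossb (fun p => (a p).2) (fun p => (b p).2) c].

(** Polymorphic in [T]: vertices for the application, pairs of zones for the enumeration. The bound
    10 is crude. *)
Definition corr_spec (a b : T -> zone) c : bool :=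
  let x := corr (map a c) (map b c) in
  (absz x <= 10)%N &&
  (nocross a b c && (x != 0) ==>
    hits3 b c && (hits3 a c ||
      hits2 a c && (betweenb (fun p => (a p).1) b c || betweenb (fun p => (a p).2) b c))).

End Patterns.

Fixpoint seqs_of (T : Type) (l : seq T) n : seq (seq T) :=
  if n is n'.+1 then [seq x :: w | x <- l, w <- seqs_of l n'] else [:: [::]].

Lemma mem_seqs_of (T : eqType) (l w : seq T) :
  all (mem l) w -> w \in seqs_of l (size w).
Proof.
elim: w => //= x w IH /andP[xl /IH wl].
exact: (allpairs_f cons xl wl).
Qed.

(** Exhaustive check of the $9^4$ ways to place four points in the zones of two segments. *)
Lemma corr_spec_zones :
  all (corr_spec fst snd) (seqs_of [seq (p, q) | p <- zones, q <- zones] 4%N).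
Proof. by vm_compute. Qed.

Lemma corr_specP (T : Type) (a b : T -> zone) (c : seq T) : size c = 4%N ->
  (forall p, (a p).2 ==> (a p).1) -> (forall p, (b p).2 ==> (b p).1) -> corr_spec a b c.
Proof.
move=> sc wa wb; pose c' := [seq (a p, b p) | p <- c].
have zoneP q : q.2 ==> q.1 -> q \in zones by case: q => [] [] [].
have : corr_spec fst snd c'.
  apply: (allP corr_spec_zones); rewrite -sc -(size_map (fun p => (a p, b p))).
  apply: mem_seqs_of; set S := [seq _ | _ <- _, _ <- _].
  have PS p : (a p, b p) \in S by apply: allpairs_f; apply: zoneP.
  by rewrite /c'; elim: (c) => //= p l ->; rewrite andbT; apply: PS.
rewrite /corr_spec /nocross /hits3 /hits2 /betweenb /crossb -!map_comp !has_map //.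
Qed.

(** * From zone patterns back to halfspaces *)

Section Pairs.
Variables (V : finType) (e : rel V).
Hypotheses (e_sym : symmetric e) (e_irr : irreflexive e).
Local Notation G := (raag e).
Implicit Types (x y z g : G) (h k : set G) (t u : seq (set G)).

Definition zone_at t x : zone := (`[< head set0 t x >], `[< last set0 t x >]).

Definition crossing s x y z : set (seq (set G)) :=
  [set t | [/\ translates_in s x z t, head set0 t y & ~ last set0 t y]].

Lemma translates_inE s x y t : Hsegment s -> is_translate s t ->
  `[< translates_in s x y t >] = ~~ (zone_at t x).1 && (zone_at t y).2.
Proof.
move=> s_seg Ht; apply/asboolP/andP => /= [/(translates_inP e_sym e_irr s_seg)[_ A B]|].
  by split; [exact/asboolPn|exact/asboolP].
by move=> [/asboolPn A /asboolP B]; apply/(translates_inP e_sym e_irr s_seg).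
Qed.

Lemma last_sub_head s t : Hsegment s -> is_translate s t -> last set0 t `<=` head set0 t.
Proof.
move=> s_seg Ht; rewrite -nth0 -nth_last (size_is_translate Ht).
by apply: (nth_subset e_sym e_irr s_seg Ht); rewrite ltn_predL (size_s_gt0 s_seg).
Qed.

Lemma zone_atP s t x : Hsegment s -> is_translate s t -> (zone_at t x).2 ==> (zone_at t x).1.
Proof.
by move=> s_seg Ht; apply/implyP => /asboolP H; apply/asboolP/(last_sub_head s_seg Ht).
Qed.

Lemma hits3_crossing s t (xs : seq G) : Hsegment s -> is_translate s t ->
  hits3 (zone_at t) xs ->
  exists x y z, [/\ x \in xs, y \in xs, z \in xs & crossing s x y z t].
Proof.
move=> s_seg Ht /and3P[/hasP[x xin /asboolPn A] /hasP[y yin]].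
move=> /andP[/asboolP B /asboolPn C] /hasP[z zin /asboolP D].
exists x, y, z; split=> //; split=> //.
exact/(translates_inP e_sym e_irr s_seg).
Qed.

(** A point violating one of the two inclusions would complete the four quadrants of [h] and an end
    of [u]. *)
Lemma between_pattern h u a b c d : halfspace h ->
  ~ transverse h (head set0 u) -> ~ transverse h (last set0 u) ->
  last set0 u `<=` head set0 u ->
  [/\ head set0 u a, ~ last set0 u a & h a] -> [/\ head set0 u b, ~ last set0 u b & ~ h b] ->
  ~ head set0 u c /\ ~ h c -> last set0 u d /\ h d -> between u h.
Proof.
move=> hh T1 T2 lh [a1 a2 a3] [b1 b2 b3] [c1 c2] [d1 d2]; split=> // z Hz.
  apply: contrapT => nz; apply: T2; split; [exists d|exists a|exists z|exists b]; split=> //.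
apply: contrapT => nz; apply: T1; split; [exists a|exists z|exists b|exists c]; split=> //.
Qed.

Lemma not_transverseC h k : ~ transverse h k -> ~ transverse (~` h) k.
Proof. by move=> H /transverseC. Qed.

Lemma halfspaceC h : halfspace h -> halfspace (~` h).
Proof.
move=> /(halfspaceP e_sym e_irr)[g [a ->]]; apply/(halfspaceP e_sym e_irr).
by exists (g * letg e a)%g, (linv a); rewrite halfspC.
Qed.

Lemma betweenbP r u h (f : G -> bool) (xs : seq G) : Hsegment r -> is_translate r u ->
  halfspace h -> (forall x, reflect (h x) (f x)) ->
  ~ transverse h (head set0 u) -> ~ transverse h (last set0 u) ->
  betweenb f (zone_at u) xs -> between u h \/ between u (~` h).
Proof.
move=> r_seg Hu hh fP T1 T2 /and3P[/hasP[a _ /andP[/andP[/asboolP a1 /asboolPn a2] /fP a3]]].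
move=> /hasP[b _ /andP[/andP[/asboolP b1 /asboolPn b2] /fP b3]].
have lh := last_sub_head r_seg Hu.
case/orP => /andP[/hasP[c _ /andP[/asboolPn c1 /fP c2]] /hasP[d _ /andP[/asboolP d1 /fP d2]]].
  by left; apply: (between_pattern hh T1 T2 lh (a := a) (b := b) (c := c) (d := d)).
by right; apply: (between_pattern (halfspaceC hh) (not_transverseC T1) (not_transverseC T2) lh
  (a := b) (b := a) (c := c) (d := d)) => //; split=> //.
Qed.

Lemma crossbP h k (f f' : G -> bool) (xs : seq G) :
  (forall x, reflect (h x) (f x)) -> (forall x, reflect (k x) (f' x)) ->
  ~ transverse h k -> ~~ crossb f f' xs.
Proof.
move=> fP kP nT; apply/negP => /and4P[/hasP[a _ /andP[/fP a1 /kP a2]]].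
move=> /hasP[b _ /andP[/fP b1 /kP b2]] /hasP[c _ /andP[/fP c1 /kP c2]].
move=> /hasP[d _ /andP[/fP d1 /kP d2]]; apply: nT.
by split; [exists a|exists b|exists c|exists d].
Qed.

Variables (s r : seq (set G)) (s_seg : Hsegment s) (r_seg : Hsegment r).
Variables s_first s_last r_first r_last : V.
Hypotheses (s_firstP : halfspace_label (head set0 s) s_first)
  (s_lastP : halfspace_label (last set0 s) s_last)
  (r_firstP : halfspace_label (head set0 r) r_first)
  (r_lastP : halfspace_label (last set0 r) r_last)
  (nadj_ff : ~~ e s_first r_first) (nadj_fl : ~~ e s_first r_last)
  (nadj_lf : ~~ e s_last r_first) (nadj_ll : ~~ e s_last r_last).

Lemma head_translate g t : t != [::] ->
  head set0 (translate g t) = [set (g * z)%g | z in head set0 t].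
Proof. by case: t. Qed.

Lemma last_translate g t : t != [::] ->
  last set0 (translate g t) = [set (g * z)%g | z in last set0 t].
Proof.
by case: t => //= h t _; apply: (last_map (fun k => [set (g * z)%g | z in k])).
Qed.

(** The nonadjacency of the end labels acts here: it makes the ends of [t] and [u] nontransverse,
    hence [nocross], and the finite check [corr_specP] applies. *)
Lemma corr_support t u (xs : seq G) : size xs = 4%N ->
  is_translate s t -> is_translate r u ->
  corr (map (zone_at t) xs) (map (zone_at u) xs) != 0 ->
  (exists x y z, [/\ x \in xs, y \in xs, z \in xs & crossing r x y z u]) /\
  ((exists x y z, [/\ x \in xs, y \in xs, z \in xs & crossing s x y z t]) \/
   exists x y, [/\ x \in xs, y \in xs, translates_in s x y t &
     (between u (head set0 t) \/ between u (~` head set0 t)) \/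
     (between u (last set0 t) \/ between u (~` last set0 t))]).
Proof.
move=> sxs Ht Hu nz.
have [s0 _ _] := s_seg; have [r0 _ _] := r_seg.
have lth : halfspace_label (head set0 t) s_first.
  by case: Ht => g ->; rewrite head_translate //; apply: label_act.
have ltl : halfspace_label (last set0 t) s_last.
  by case: Ht => g ->; rewrite last_translate //; apply: label_act.
have luh : halfspace_label (head set0 u) r_first.
  by case: Hu => g ->; rewrite head_translate //; apply: label_act.
have lul : halfspace_label (last set0 u) r_last.
  by case: Hu => g ->; rewrite last_translate //; apply: label_act.
have Thh := not_transverse e_sym e_irr nadj_ff lth luh.
have Thl := not_transverse e_sym e_irr nadj_fl lth lul.
have Tlh := not_transverse e_sym e_irr nadj_lf ltl luh.
have Tll := not_transverse e_sym e_irr nadj_ll ltl lul.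
have hP w x : reflect (head set0 w x) (zone_at w x).1 by apply: asboolP.
have lP w x : reflect (last set0 w x) (zone_at w x).2 by apply: asboolP.
have nc : nocross (zone_at t) (zone_at u) xs.
  apply/and4P; split; [exact: crossbP (hP t) (hP u) Thh|exact: crossbP (hP t) (lP u) Thl
    |exact: crossbP (lP t) (hP u) Tlh|exact: crossbP (lP t) (lP u) Tll].
have /andP[_] := corr_specP sxs (fun x => @zone_atP s t x s_seg Ht)
  (fun x => @zone_atP r u x r_seg Hu).
rewrite nc nz [_ ==> _]/=.
move=> /andP[/(hits3_crossing r_seg Hu) H1 H2]; split=> //.
case/orP: H2 => [/(hits3_crossing s_seg Ht) H2|]; first by left.
move=> /andP[/andP[/hasP[x xin /hP hx] /hasP[y yin /lP ly]] H]; right.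
exists x, y; split=> //; first exact/(translates_inP e_sym e_irr s_seg).
have hth : halfspace (head set0 t).
  rewrite -nth0; apply: (nth_halfspace e_sym e_irr s_seg Ht); exact: size_s_gt0.
have htl : halfspace (last set0 t).
  rewrite -nth_last (size_is_translate Ht); apply: (nth_halfspace e_sym e_irr s_seg Ht).
  by rewrite ltn_predL (size_s_gt0 s_seg).
case/orP: H => H; [left|right].
  exact: (betweenbP r_seg Hu hth (hP t) Thh Thl H).
exact: (betweenbP r_seg Hu htl (lP t) Tlh Tll H).
Qed.

End Pairs.

(** * Summation over translates *)

Lemma sum_covered (R : realType) (X : eqType) (E : seq X) (A : set X) n (f : X -> R) (C : R) :
  uniq E -> covered n A -> (forall t, t \in E -> f t != 0 -> A t) ->
  (forall t, t \in E -> `|f t| <= C) -> 0 <= C -> `|\sum_(t <- E) f t| <= C * n%:R.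
Proof.
move=> uE [L [sL AL]] fA fC C0.
rewrite (bigID (fun t => f t == 0)) /= big1 ?add0r; last by move=> t /eqP.
rewrite -big_filter; set E' := filter _ E.
have E'sub t : t \in E' -> t \in E /\ t \in L.
  by rewrite mem_filter => /andP[ft tE]; split=> //; apply/AL/fA.
have sE' : (size E' <= n)%N.
  apply: leq_trans sL; apply: uniq_leq_size; first exact: filter_uniq.
  by move=> t /E'sub[].
apply: le_trans (ler_norm_sum _ _ _) _.
apply: (@le_trans _ _ (\sum_(t <- E') C)).
  by rewrite big_seq [leRHS]big_seq; apply: ler_sum => t /E'sub[tE _]; apply: fC.
by rewrite big_const_seq count_predT iter_addr_0 -[leLHS]mulr_natr ler_wpM2l // ler_nat.
Qed.

Lemma card_fset_set_sum (R : realType) (X : choiceType) (A : set X) (E : seq X) :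
  uniq E -> (forall t, A t -> t \in E) ->
  (#|` fset_set A|)%:R = \sum_(t <- E) (`[< A t >] : nat)%:R :> R.
Proof.
move=> uE AE; rewrite -natr_sum; congr _%:R.
have finA : finite_set A.
  by apply/finite_seqP; exists (filter (fun t => `[< A t >]) E); apply/funext => t;
    apply/propext => /=; rewrite mem_filter; split=> [At|/andP[/asboolP]//];
    rewrite AE // andbT; apply/asboolP.
transitivity (size (filter (fun t => `[< A t >]) E)); last first.
  by rewrite size_filter -sum1_count big_mkcond; apply: eq_bigr => t _; case: asbool.
apply: perm_size; apply: uniq_perm; [exact: fset_uniq|exact: filter_uniq|].
move=> t; rewrite mem_filter in_fset_set // ; apply/idP/andP => [|[/asboolP At _]].
  by move/set_mem => At; split; [exact/asboolP|exact: AE].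
exact: mem_set.
Qed.

(** * Cochains as sums over a common list of translates *)

Section Sums.
Variables (R : realType) (V : finType) (e : rel V).
Hypotheses (e_sym : symmetric e) (e_irr : irreflexive e).
Local Notation G := (raag e).
Implicit Types (x y z g : G) (h k : set G) (s t u : seq (set G)).
Local Notation F s := (median_cocycle R s).

(* For the median $m$ of $x,y,z$, this is the number of translates of [s]
   contained in $[x,m]_{\mathcal{H}}$ minus the number of those in
   $[m,x]_{\mathcal{H}}$. *)
Definition gromov s x y z : R :=
  (#|` fset_set (translates_in s x y `&` translates_in s x z)|)%:R
  - (#|` fset_set (translates_in s y x `&` translates_in s z x)|)%:R.

Definition defect s x y z : R := F s y z - F s x z + F s x y.

(** One index list for all translates that can contribute at the points of [xs], so that cochains
    can be combined term by term. *)
Definition enumerates s (xs : seq G) (E : seq (seq (set G))) : Prop :=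
  [/\ uniq E, forall t, t \in E -> is_translate s t &
      forall x y t, x \in xs -> y \in xs -> translates_in s x y t -> t \in E].

Lemma enumerates_ex s (xs : seq G) : Hsegment s -> exists E, enumerates s xs E.
Proof.
move=> s_seg.
have H (l : seq (G * G)) : exists E : seq (seq (set G)),
    forall p t, p \in l -> translates_in s p.1 p.2 t -> t \in E.
  elim: l => [|p l [E HE]]; first by exists [::].
  have [n [L [_ HL]]] := translates_in_finite e_sym e_irr s_seg p.1 p.2.
  exists (L ++ E) => q t; rewrite inE mem_cat => /predU1P[->|ql] Ht.
    by rewrite HL.
  by rewrite (HE q) ?orbT.
have [E HE] := H [seq (x, y) | x <- xs, y <- xs].
exists (undup [seq t <- E | `[< is_translate s t >]]); split; first exact: undup_uniq.
  by move=> t; rewrite mem_undup mem_filter => /andP[/asboolP].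
move=> x y t xin yin Ht; rewrite mem_undup mem_filter.
rewrite (HE (x, y)) ?andbT //; first by apply/asboolP; case: Ht.
exact: allpairs_f.
Qed.

Lemma median_sum s xs E x y : Hsegment s -> enumerates s xs E -> x \in xs -> y \in xs ->
  F s x y = \sum_(t <- E) (dir (zone_at t x) (zone_at t y))%:~R.
Proof.
move=> s_seg [uE tE HE] xin yin; rewrite /median_cocycle.
rewrite (@card_fset_set_sum R _ _ E) //; last by move=> t; apply: HE.
rewrite (@card_fset_set_sum R _ _ E) //; last by move=> t; apply: HE.
rewrite -sumrB big_seq [RHS]big_seq; apply: eq_bigr => t /tE Ht.
by rewrite !(translates_inE e_sym e_irr _ _ s_seg Ht) /dir rmorphB.
Qed.

Lemma gromov_sum s xs E x y z : Hsegment s -> enumerates s xs E ->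
  x \in xs -> y \in xs -> z \in xs ->
  gromov s x y z =
    \sum_(t <- E) (overlap (zone_at t x) (zone_at t y) (zone_at t z))%:~R.
Proof.
move=> s_seg [uE tE HE] xin yin zin; rewrite /gromov.
rewrite (@card_fset_set_sum R _ _ E) //; last by move=> t [+ _]; apply: HE.
rewrite (@card_fset_set_sum R _ _ E) //; last by move=> t [+ _]; apply: HE.
rewrite -sumrB big_seq [RHS]big_seq; apply: eq_bigr => t /tE Ht.
have I A B : `[< (A `&` B) t >] = `[< A t >] && `[< B t >] .
  exact: asbool_and.
rewrite !I !(translates_inE e_sym e_irr _ _ s_seg Ht) /overlap rmorphB //.
Qed.

Lemma defect_sum s xs E x y z : Hsegment s -> enumerates s xs E ->
  x \in xs -> y \in xs -> z \in xs ->
  defect s x y z = \sum_(t <- E) (turn (zone_at t x) (zone_at t y) (zone_at t z))%:~R.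
Proof.
move=> s_seg HE xin yin zin; rewrite /defect !(median_sum s_seg HE) //.
rewrite -sumrB -big_split; apply: eq_bigr => t _ /=.
by rewrite /turn [RHS]intrD; congr (_ + _); rewrite [RHS]intrB.
Qed.

Lemma covered_crossings s (xs : seq G) : Hsegment s ->
  covered (size xs * (size xs * (size xs * size s)))
    [set t | exists x y z, [/\ x \in xs, y \in xs, z \in xs & crossing s x y z t]].
Proof.
move=> s_seg.
have H x y z := covered_crossing e_sym e_irr s_seg x y z.
have := covered_bigcup xs (fun x => covered_bigcup xs (fun y => covered_bigcup xs (H x y))).
apply: covered_sub => t [x [y [z [xin yin zin Ht]]]].
by exists x => //; exists y => //; exists z.
Qed.

Lemma turn_bound (p q r : zone) :
  p.2 ==> p.1 -> q.2 ==> q.1 -> r.2 ==> r.1 ->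
  (absz (turn p q r) <= 3)%N && ((turn p q r != 0) ==> hits3 id [:: p; q; r]).
Proof. by case: p q r => [[] []] [[] []] [[] []]. Qed.

Lemma defect_bounded s : Hsegment s -> exists D : R, forall x y z, `|defect s x y z| <= D.
Proof.
(* At most $3^3$ times [size s] translates have the points in three zones, and each contributes at
   most 3. *)
move=> s_seg; exists (3%:R * (3 * (3 * (3 * size s)))%N%:R) => x y z.
pose xs := [:: x; y; z].
have [E HE] := enumerates_ex xs s_seg; have [uE tE _] := HE.
rewrite (defect_sum s_seg HE) ?inE ?eqxx ?orbT //.
have wf t w : t \in E -> (zone_at t w).2 ==> (zone_at t w).1.
  by move=> /tE Ht; apply: (zone_atP e_sym e_irr w s_seg Ht).
have tb t : t \in E -> _ := fun Ht => turn_bound (wf t x Ht) (wf t y Ht) (wf t z Ht).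
apply: (sum_covered uE (covered_crossings xs s_seg)) => // t Ht.
  rewrite intr_eq0 => nz; have /andP[_ /implyP/(_ nz)] := tb t Ht.
  rewrite -[[:: _; _; _]]/(map (zone_at t) xs) => H.
  apply: (hits3_crossing e_sym e_irr s_seg (tE t Ht)).
  by move: H; rewrite /hits3 !has_map.
by have /andP[H _] := tb t Ht; rewrite -intr_norm -abszE -pmulrn ler_nat.
Qed.

End Sums.

(** * Boundedness of the corrected primitive *)

Section Bound.
Variables (R : realType) (V : finType) (e : rel V).
Hypotheses (e_sym : symmetric e) (e_irr : irreflexive e).
Local Notation G := (raag e).
Implicit Types (x y z g : G) (h k : set G) (s t u : seq (set G)).
Variables (s r : seq (set G)) (s_seg : Hsegment s) (r_seg : Hsegment r).
Variables s_first s_last r_first r_last : V.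
Hypotheses (s_firstP : halfspace_label (head set0 s) s_first)
  (s_lastP : halfspace_label (last set0 s) s_last)
  (r_firstP : halfspace_label (head set0 r) r_first)
  (r_lastP : halfspace_label (last set0 r) r_last)
  (nadj_ff : ~~ e s_first r_first) (nadj_fl : ~~ e s_first r_last)
  (nadj_lf : ~~ e s_last r_first) (nadj_ll : ~~ e s_last r_last).

Local Notation F := (median_cocycle R s).
Local Notation omega := (defect R r).
Local Notation K := (fun x y z => gromov R s x y z * omega x y z).

Lemma corr_sum (xs : seq G) (Es Er : seq (seq (set G))) x0 x1 x2 x3 :
  xs = [:: x0; x1; x2; x3] -> enumerates s xs Es -> enumerates r xs Er ->
  F x0 x1 * omega x1 x2 x3 + (K x1 x2 x3 - K x0 x2 x3 + K x0 x1 x3 - K x0 x1 x2) =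
  \sum_(u <- Er) \sum_(t <- Es) (corr (map (zone_at t) xs) (map (zone_at u) xs))%:~R.
Proof.
move=> xsE Hs Hr; have xin n : (n < 4)%N -> nth 1%g xs n \in xs.
  by move=> n4; apply: mem_nth; rewrite xsE.
have i0 := xin 0%N isT; have i1 := xin 1%N isT; have i2 := xin 2%N isT.
have i3 := xin 3%N isT; rewrite {}xsE /= in i0 i1 i2 i3 Hs Hr *.
rewrite !(gromov_sum R e_sym e_irr s_seg Hs) // (median_sum R e_sym e_irr s_seg Hs) //.
rewrite !(defect_sum R e_sym e_irr r_seg Hr) //.
pose S (f : seq (set G) -> seq (set G) -> R) := \sum_(u <- Er) \sum_(t <- Es) f u t.
have SM (a b : seq (set G) -> R) :
    (\sum_(t <- Es) a t) * (\sum_(u <- Er) b u) = S (fun u t => a t * b u).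
  by rewrite big_distrlr exchange_big.
have SD f f' : S f + S f' = S (fun u t => f u t + f' u t).
  by rewrite /S -big_split; apply: eq_bigr => u _; rewrite big_split.
have SB f f' : S f - S f' = S (fun u t => f u t - f' u t).
  by rewrite /S -sumrB; apply: eq_bigr => u _; rewrite sumrB.
rewrite !SM SB SD SB SD; apply: eq_bigr => u _; apply: eq_bigr => t _ /=.
have intrE (a b c d a' b' c' d' a'' b'' : int) :
    (a * b + (c * d - a' * b' + c' * d' - a'' * b''))%:~R =
    a%:~R * b%:~R + (c%:~R * d%:~R - a'%:~R * b'%:~R + c'%:~R * d'%:~R
                     - a''%:~R * b''%:~R) :> R.
  by rewrite !(intrD, intrN, intrM).
by rewrite /corr intrE.
Qed.

Lemma cup_bounded : exists M : R, forall x0 x1 x2 x3,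
  `|F x0 x1 * omega x1 x2 x3 + (K x1 x2 x3 - K x0 x2 x3 + K x0 x1 x3 - K x0 x1 x2)| <= M.
Proof.
have [nb Hnb] := covered_between e_sym e_irr r_seg.
(* The second alternative of [corr_support]. In an interval, a translate is determined by its first
   or by its last halfspace, so the bound on [between u] limits these [t] uniformly in [u]. *)
pose near x y u : set (seq (set G)) := [set t | translates_in s x y t /\
  ((between u (head set0 t) \/ between u (~` head set0 t)) \/
   (between u (last set0 t) \/ between u (~` last set0 t)))].
have Hnear x y u : is_translate r u ->
    covered ((nb + nb) + (nb + nb)) (near x y u).
  move=> Hu; have [L [sL HL]] := Hnb u Hu.
  pose L' := L ++ map (fun h => ~` h) L.
  have sL' : (size L' <= nb + nb)%N by rewrite size_cat size_map leq_add.
  have HL' h : between u h \/ between u (~` h) -> h \in L'.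
    rewrite mem_cat => -[/HL ->//|/HL H]; apply/orP; right.
    by apply/mapP; exists (~` h) => //; rewrite setCK.
  have c1 : covered (nb + nb) [set t | translates_in s x y t /\
      (between u (head set0 t) \/ between u (~` head set0 t))].
    apply: (covered_inj (f := head set0) sL'); first by move=> t [_ /HL'].
    move=> t t' [Ht _] [Ht' _]; exact: (head_inj e_sym e_irr s_seg Ht Ht').
  have c2 : covered (nb + nb) [set t | translates_in s x y t /\
      (between u (last set0 t) \/ between u (~` last set0 t))].
    apply: (covered_inj (f := last set0) sL'); first by move=> t [_ /HL'].
    move=> t t' [Ht _] [Ht' _]; exact: (last_inj e_sym e_irr s_seg Ht Ht').
  by apply: covered_sub (covered_setU c1 c2) => t [Ht [H|H]]; [left|right].
(* For fixed [u]: the three-zone translates [t], then those near [u]. The factors 4 account for the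
   choice of points in [xs]. *)
pose N1 := (4 * (4 * (4 * size s)) + 4 * (4 * ((nb + nb) + (nb + nb))))%N.
pose N2 := (4 * (4 * (4 * size r)))%N.
exists (10%:R * N1%:R * N2%:R) => x0 x1 x2 x3; pose xs := [:: x0; x1; x2; x3].
have [Es HEs] := enumerates_ex e_sym e_irr xs s_seg.
have [Er HEr] := enumerates_ex e_sym e_irr xs r_seg.
rewrite (corr_sum (erefl xs) HEs HEr).
have [uEs tEs _] := HEs; have [uEr tEr _] := HEr.
have supp t u (Ht : is_translate s t) (Hu : is_translate r u) :=
  @corr_support V e e_sym e_irr s r s_seg r_seg s_first s_last r_first r_last s_firstP
    s_lastP r_firstP r_lastP nadj_ff nadj_fl nadj_lf nadj_ll t u xs erefl Ht Hu.
have C0 : 0 <= 10%:R :> R by rewrite ler0n.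
apply: (sum_covered uEr (covered_crossings e_sym e_irr xs r_seg)).
- move=> u uE; apply: contra_neqP => nA; rewrite big_seq big1 // => t tE.
  apply/eqP; rewrite intr_eq0; apply: contra_notT nA => nz.
  by have [] := supp t u (tEs t tE) (tEr u uE) nz.
- move=> u /tEr Hu.
  have cu : covered N1 ([set t | exists x y z,
      [/\ x \in xs, y \in xs, z \in xs & crossing s x y z t]] `|`
      [set t | exists2 x, x \in xs & exists2 y, y \in xs & near x y u t]).
    apply: covered_setU (covered_crossings e_sym e_irr xs s_seg) _.
    apply: (covered_bigcup xs (A := fun x => [set t | exists2 y, y \in xs & near x y u t])).
    move=> x; apply: (covered_bigcup xs (A := fun y => near x y u)) => y.
    exact: Hnear.
  apply: (sum_covered uEs cu) => // t /tEs Ht.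
    rewrite intr_eq0 => /(supp t u Ht Hu)[_ [H|]]; first by left.
    by move=> [x [y [xin yin H1 H2]]]; right; exists x => //; exists y.
  have /andP[H _] := corr_specP (c := xs) erefl
    (fun x => @zone_atP V e e_sym e_irr s t x s_seg Ht)
    (fun x => @zone_atP V e e_sym e_irr r u x r_seg Hu).
  by rewrite -intr_norm -abszE -pmulrn ler_nat.
- by rewrite mulr_ge0 // ler0n.
Qed.

End Bound.

(** * The cup product *)

Lemma covered_finite (X : choiceType) n (A : set X) : covered n A -> finite_set A.
Proof.
by move=> [L [_ HL]]; apply: (@sub_finite_set _ _ [set` L]).
Qed.

Lemma card_fset_set_bij (X : choiceType) (f f' : X -> X) (A B : set X) :
  cancel f f' -> cancel f' f -> finite_set A -> (forall t, B (f t) <-> A t) ->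
  #|` fset_set B| = #|` fset_set A|.
Proof.
move=> fK f'K finA BA.
have -> : B = f @` A.
  apply/seteqP; split=> [t Bt|_ [t /BA Bt <-]//].
  by exists (f' t); rewrite ?f'K //; apply/BA; rewrite f'K.
rewrite fset_set_image // card_imfset //; exact: can_inj fK.
Qed.

(** * Invariance, and the coboundary of the median quasimorphism *)

Section Invariance.
Variables (R : realType) (V : finType) (e : rel V).
Hypotheses (e_sym : symmetric e) (e_irr : irreflexive e).
Local Notation G := (raag e).
Variable s : seq (set G).
Hypothesis s_seg : Hsegment s.

Let translateK (g : G) : cancel (translate g) (translate g^-1%g).
Proof. by move=> t; rewrite translateM mulVg translate1. Qed.

Let translateVK (g : G) : cancel (translate g^-1%g) (translate g).
Proof. by move=> t; rewrite translateM mulgV translate1. Qed.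

Let finT (x y : G) : finite_set (translates_in s x y).
Proof. by have [n /covered_finite] := translates_in_finite e_sym e_irr s_seg x y. Qed.

Lemma median_act (g x y : G) :
  median_cocycle R s (g * x)%g (g * y)%g = median_cocycle R s x y.
Proof.
rewrite /median_cocycle; congr (_%:R - _%:R);
  apply: (card_fset_set_bij (translateK g) (translateVK g)) (finT _ _) _ => t;
  exact: translates_in_act.
Qed.

Lemma gromov_act (g x y z : G) :
  gromov R s (g * x)%g (g * y)%g (g * z)%g = gromov R s x y z.
Proof.
have E x' y' t := translates_in_act e_sym e_irr s g x' y' t.
rewrite /gromov; congr (_%:R - _%:R);
  apply: (card_fset_set_bij (translateK g) (translateVK g)) (finite_setIl _ (finT _ _)) _ => t;
  by split=> -[/E ? /E ?].
Qed.

Lemma defect_act (g x y z : G) :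
  defect R s (g * x)%g (g * y)%g (g * z)%g = defect R s x y z.
Proof. by rewrite /defect !median_act. Qed.

(** The defect at [(a, b)] is $\delta f_s$ at the points $x,ax,abx$. *)
Lemma median_qm_quasimorphism x : quasimorphism (median_qm R s x).
Proof.
have [D HD] := defect_bounded R e_sym e_irr s_seg; exists D => a b.
have := HD x (a * x)%g (a * (b * x))%g; rewrite /defect median_act /median_qm.
by rewrite addrAC [X in X - _]addrC mulgA.
Qed.

Lemma qhat_median x (h : 'I_2 -> G) :
  qhat (median_qm R s x) h = median_cocycle R s (h ord0 * x)%g (h ord_max * x)%g.
Proof. by rewrite /qhat /median_qm -(median_act (h ord0)) -mulgA mulVKg. Qed.

Lemma coboundary_qhat_median x (h : 'I_3 -> G) :
  coboundary (qhat (median_qm R s x)) h =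
    defect R s (h (inord 0) * x)%g (h (inord 1) * x)%g (h (inord 2) * x)%g.
Proof.
rewrite /coboundary !big_ord_recl big_ord0 !qhat_median /defect addr0.
rewrite expr0 expr1 sqrrN mul1r mulN1r expr1n mul1r addrA.
congr (median_cocycle R s (_ * x)%g (_ * x)%g - median_cocycle R s (_ * x)%g (_ * x)%g
   + median_cocycle R s (_ * x)%g (_ * x)%g);
  by congr h; apply: val_inj; rewrite /= inordK.
Qed.

End Invariance.

Lemma coboundary2E (R : realType) (G : groupType) (K : G -> G -> G -> R) (g : 'I_4 -> G) :
  coboundary (fun h : 'I_3 -> G => K (h (inord 0)) (h (inord 1)) (h (inord 2))) g =
  K (g (inord 1)) (g (inord 2)) (g (inord 3)) - K (g (inord 0)) (g (inord 2)) (g (inord 3))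
  + K (g (inord 0)) (g (inord 1)) (g (inord 3)) - K (g (inord 0)) (g (inord 1)) (g (inord 2)).
Proof.
rewrite /coboundary !big_ord_recl big_ord0 addr0.
have -> : (-1) ^+ (lift ord0 (lift ord0 (lift ord0 ord0)) : 'I_4) = -1 :> R.
  by rewrite /= exprS sqrrN expr1n mulr1.
rewrite expr0 expr1 sqrrN mul1r !mulN1r expr1n mul1r !addrA.
congr (K _ _ _ - K _ _ _ + K _ _ _ - K _ _ _);
  by congr g; apply: val_inj; rewrite /= !inordK //= /bump /= !inordK.
Qed.

Theorem corollary1p7 (R : realType) (V : finType) (e : rel V)
    (e_sym : symmetric e) (e_irr : irreflexive e)
    (x : raag e) (s r : seq (set (raag e)))
    (s_seg : Hsegment s) (r_seg : Hsegment r)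
    (s_first s_last r_first r_last : V)
    (s_firstP : halfspace_label (head set0 s) s_first)
    (s_lastP : halfspace_label (last set0 s) s_last)
    (r_firstP : halfspace_label (head set0 r) r_first)
    (r_lastP : halfspace_label (last set0 r) r_last)
    (nadj_ff : ~~ e s_first r_first) (nadj_fl : ~~ e s_first r_last)
    (nadj_lf : ~~ e s_last r_first) (nadj_ll : ~~ e s_last r_last) :
  exists (s_qm : quasimorphism (median_qm R s x))
         (r_qm : quasimorphism (median_qm R r x)),
    cupH (qclass s_qm) (qclass r_qm) = 0 :> Hb R (raag e) 4.
Proof.
have s_qm := median_qm_quasimorphism R e_sym e_irr s_seg x.
have r_qm := median_qm_quasimorphism R e_sym e_irr r_seg x.
exists s_qm, r_qm; rewrite /qclass cupH_class.
have -> : 0 = Hclass 0 :> Hb R (raag e) 4 by rewrite /Hclass pi_zeror.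
apply/Hclass_eq; rewrite subr0 /=.
pose fs := qhat (median_qm R s x); pose fr := qhat (median_qm R r x).
pose K (a b c : raag e) :=
  gromov R s (a * x)%g (b * x)%g (c * x)%g * defect R r (a * x)%g (b * x)%g (c * x)%g.
pose eta (h : 'I_3 -> raag e) := K (h (inord 0)) (h (inord 1)) (h (inord 2)).
pose f1 : ('I_(1 + 2).+1 -> raag e) -> R := cup fs (coboundary fr).
pose f2 : ('I_(1 + 2).+1 -> raag e) -> R := coboundary (eta : ('I_2.+1 -> raag e) -> R).
have f1E h : f1 h = median_cocycle R s (h (inord 0) * x)%g (h (inord 1) * x)%g *
    defect R r (h (inord 1) * x)%g (h (inord 2) * x)%g (h (inord 3) * x)%g.
  rewrite /f1 /cup /fs /fr qhat_median // coboundary_qhat_median //.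
  by rewrite !inordK.
have f2E h : f2 h = _ := coboundary2E K h.
(* In degree [2 + 2] a bounded invariant 3-cochain is required; [1 + 2] and [2.+1] both compute to
   3. *)
exists (f1 + f2); split; last first.
  have -> : coboundary (f1 + f2) = coboundary f1 + coboundary f2 := raddfD _ _ _.
  (* By the Leibniz rule and $\delta\delta=0$, [f1] is a primitive of the cup product, and adding
     the coboundary [f2] does not alter this. *)
  rewrite coboundaryK addr0; apply/funext => g; rewrite [RHS]coboundary_cup.
  rewrite coboundaryK /= [X in _ * (_ * X)]/(0 : R) !mulr0 addr0 //.
split.
  have [M HM] := cup_bounded R e_sym e_irr s_seg r_seg s_firstP s_lastP r_firstP r_lastP
    nadj_ff nadj_fl nadj_lf nadj_ll.
  by exists M => h; rewrite /GRing.add /= f1E f2E; apply: HM.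
move=> a h; rewrite /GRing.add /= !f1E !f2E /K -!mulgA.
by rewrite !median_act // !gromov_act // !defect_act.
Qed.
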